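(* Let $N$ be a weighted planar bipartite network in a disk with $n$ boundary vertices. Suppose $N$ has nonnegative real weights, and that almost perfect matchings of $N$ exist. Let $k=d'+d$ be the integer attached to $N$. Then the homogeneous coordinates $\{\Delta_I(N)\mid I\subset[n],\ |I|=k\}$ define a point $X(N)$ in the Grassmannian $\mathrm{Gr}(k,n)$; that is, they are the Plücker coordinates of a point $X(N)$.
   Context: A planar bipartite network $N$ is a weighted bipartite graph embedded in a disk, with $n$ boundary vertices labeled $1,2,\dots,n$ in clockwise order, all other vertices being interior. Each vertex is colored black or white, and every edge joins a black vertex to a white vertex. All boundary vertices have degree $1$, and edges cannot join boundary vertices to boundary vertices (so the color of a boundary vertex is determined by the color of the interior vertex it is joined to). Let $d$ be the number of interior white vertices minus the number of interior black vertices, let $d'$ be the number of boundary vertices incident to an interior black vertex, and put $k=d'+d$. An almost perfect matching $\Pi$ of $N$ is a subset of edges of $N$ such that each interior vertex is used exactly once, while each boundary vertex (having degree $1$) may or may not be used. Its boundary subset $I(\Pi)\subset[n]=\{1,\dots,n\}$ is the set of black boundary vertices that are used by $\Pi$ union the set of white boundary vertices that are not used by $\Pi$; one has $|I(\Pi)|=k$. The weight $\mathrm{wt}(\Pi)$ is the product of the weights of the edges in $\Pi$. For a $k$-element subset $I\subset[n]$, the boundary measurement is $\Delta_I(N)=\sum_{\Pi:\,I(\Pi)=I}\mathrm{wt}(\Pi)$. $\mathrm{Gr}(k,n)$ is the Grassmannian of $k$-dimensional subspaces of $\mathbb{C}^n$. A point is the row span of a full rank $k\times n$ matrix, and its Plücker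 coordinate $\Delta_I$, for a $k$-element subset $I\subset[n]$, is the $k\times k$ minor in the columns indexed by $I$; the collection of Plücker coordinates is well defined up to a common scalar and embeds $\mathrm{Gr}(k,n)$ in the projective space with homogeneous coordinates indexed by the $k$-element subsets of $[n]$.
   Formalization: The existence of almost perfect matchings is taken to mean that one of nonzero weight exists: weights may be zero, and if every almost perfect matching has weight 0, all Δ_I(N) vanish and define no point of Gr(k,n). *)

(* Defs.v *)
From HB Require Import structures.
From mathcomp Require Import all_boot all_order all_algebra.
From mathcomp Require Import all_classical all_reals all_analysis.
From mathcomp Require Import complex.

Set Implicit Arguments.
Unset Strict Implicit.
Unset Printing Implicit Defensive.

Import Order.TTheory GRing.Theory Num.Theory.
Import numFieldNormedType.Exports.
Local Open Scope ring_scope.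

(* Parallel edges are allowed: [edge] is an abstract finite type with endpoint
   maps. The boundary vertices 1, ..., n are the elements of 'I_n, that is,
   0, ..., n-1. *)
Record network (R : realType) (n : nat) := Network {
  ivert : finType;
  edge : finType;
  is_black : 'I_n + ivert -> bool;
  black_end : edge -> 'I_n + ivert;
  white_end : edge -> 'I_n + ivert;
  weight : edge -> R;
  black_endP : forall e, is_black (black_end e);
  white_endP : forall e, ~~ is_black (white_end e);
  boundary_deg1 : forall i : 'I_n,
    #|[set e | (black_end e == inl i) || (white_end e == inl i)]| = 1%N;
  no_boundary_edge : forall (e : edge) (i j : 'I_n),
    ~ (black_end e = inl i /\ white_end e = inl j)
}.

Section Networks.
Variables (R : realType) (n : nat) (N : network R n).

Definition incident (e : edge N) (v : 'I_n + ivert N) : bool :=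
  (black_end e == v) || (white_end e == v).

(* An embedding in the closed unit disk of R^2. The boundary vertices are at
   the points of angle [bangle i] of the unit circle; labels increase
   clockwise, so angles decrease, by less than a full turn in total. *)
Record disk_embedding := DiskEmbedding {
  vpos : 'I_n + ivert N -> R * R;
  curve : edge N -> R -> R * R;
  bangle : 'I_n -> R;
  vpos_boundary : forall i : 'I_n,
    vpos (inl i) = (cos (bangle i), sin (bangle i));
  bangle_clockwise : forall i j : 'I_n, (i < j)%N ->
    bangle j < bangle i < bangle j + 2 * pi;
  vpos_interior : forall v : ivert N,
    (vpos (inr v)).1 ^+ 2 + (vpos (inr v)).2 ^+ 2 < 1;
  vpos_inj : injective vpos;
  curve_continuous : forall e, {within `[0, 1], continuous (curve e)}%classic;
  curve_inj : forall e, {in `[0, 1] &, injective (curve e)};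
  curve_in_disk : forall e t, t \in `[0, 1] ->
    (curve e t).1 ^+ 2 + (curve e t).2 ^+ 2 <= 1;
  curve0 : forall e, curve e 0 = vpos (black_end e);
  curve1 : forall e, curve e 1 = vpos (white_end e);
  curve_avoids_vertices : forall e t v, t \in `]0, 1[ -> curve e t <> vpos v;
  curve_disjoint : forall e e' t t', e != e' ->
    t \in `]0, 1[ -> t' \in `]0, 1[ -> curve e t <> curve e' t'
}.

Definition net_d : int :=
  #|[set v : ivert N | ~~ is_black (inr v)]|%:Z
  - #|[set v : ivert N | is_black (inr v)]|%:Z.

Definition net_d' : nat :=
  #|[set i : 'I_n | [exists e : edge N, exists v : ivert N,
      [&& incident e (inl i), incident e (inr v) & is_black (inr v)]]]|.

Definition almost_perfect (Pi : {set edge N}) : bool :=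
  [forall v : ivert N, #|[set e in Pi | incident e (inr v)]| == 1%N].

Definition bd_used (Pi : {set edge N}) (i : 'I_n) : bool :=
  [exists e in Pi, incident e (inl i)].

Definition bd_subset (Pi : {set edge N}) : {set 'I_n} :=
  [set i | if is_black (inl i : 'I_n + ivert N) then bd_used Pi i
           else ~~ bd_used Pi i].

Definition wt (Pi : {set edge N}) : R := \prod_(e in Pi) weight e.

Definition boundary_measurement (I : {set 'I_n}) : R :=
  \sum_(Pi : {set edge N} | almost_perfect Pi && (bd_subset Pi == I)) wt Pi.

End Networks.

Section Grassmannian.
Variables (F : fieldType) (k n : nat).

Definition ksubset : Type := {I : {set 'I_n} | #|I| == k}.

Definition Gr : Type := {V : {vspace 'rV[F]_n} | \dim V == k}.

Definition row_span (A : 'M[F]_(k, n)) : {vspace 'rV[F]_n} :=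
  <<[seq row i A | i <- enum 'I_k]>>%VS.

(* [enum_val] lists the elements of [I] in increasing order. *)
Definition ksubset_col (I : ksubset) (j : 'I_k) : 'I_n :=
  enum_val (cast_ord (esym (eqP (valP I))) j).

Definition kminor (A : 'M[F]_(k, n)) (I : ksubset) : F :=
  \det (colsub (ksubset_col I) A).

(* Equality of homogeneous coordinates is equality up to a nonzero scalar. *)
Definition plucker_coordinates (X : Gr) (p : ksubset -> F) : Prop :=
  exists A : 'M[F]_(k, n),
    [/\ \rank A = k, row_span A = val X
      & exists2 c : F, c != 0 & forall I : ksubset, kminor A I = c * p I].

End Grassmannian.

(* Main.v *)
Require Import Defs.
From mathcomp Require Import all_boot all_order all_algebra.
From mathcomp Require Import all_classical all_reals all_analysis.
From mathcomp Require Import complex zify ring lra.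
From mathcomp Require Import fintype finset.

Set Implicit Arguments.
Unset Strict Implicit.
Unset Printing Implicit Defensive.

Import Order.TTheory GRing.Theory Num.Theory.
Import numFieldNormedType.Exports.
Local Open Scope ring_scope.

(** Plucker coordinates are characterized by quadratic relations, and boundary
    measurements satisfy these relations because of an involution on pairs of
    matchings that reverses signs.

    Algebra. For sets A of size k-1 and B of size k+1 the relation says that
    the sum over x in B \ A of the terms (-1)^s p(A + x) p(B - x) vanishes,
    where s counts the elements of A and of B below x. A function p that
    satisfies all of these relations and does not vanish at I0 is determined
    by its values at I0 and at the sets that differ from I0 in one element
    ([plucker_unique]). A matrix that contains the identity in the columns of
    I0 can be given these values as minors, and minors satisfy the relations,
    so that p is the vector of Plucker coordinates of the row span
    ([plucker_point]).

    Combinatorics. Superpose two almost perfect matchings with boundary subsets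
    A + x and B - x. In the union the component of x is a path with exactly one
    other end y, by the dynamics of two involutions ([two_ends]). Swapping the
    matchings along this path preserves the product of their weights. Since all
    boundary subsets have the same size k ([card_bd_subset]), y lies in B \ A
    and the new boundary subsets are A + y and B - y. The swap is an involution,
    so the relation holds for boundary measurements as soon as the signs of the
    terms for x and y are opposite.

    Topology. The signs are opposite when the number of elements of the
    symmetric difference of A and B strictly between x and y is even. Each of
    these elements is an end of a path of the superposition disjoint from the
    path of x and y. In the disk two disjoint paths cannot have interlaced ends
    ([curves_cross], which follows from a planar Poincare-Miranda theorem), so
    these elements are ends of the same paths in pairs.

    Finally, the coordinate at the boundary subset of a matching of nonzero
    weight is a sum of nonnegative terms one of which is positive, so that not
    all coordinates vanish. *)

(** * From the Plucker relations to a point of the Grassmannian *)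

Section Rank.
Variable n : nat.
Implicit Types (S : {set 'I_n}) (x y : 'I_n).

(** The rank of x in S. Indexing columns by rank instead of by an enumeration
    keeps reindexing out of the Laplace expansions. *)
Definition below S x : nat := #|[set y in S | (y < x)%N]|.

Lemma below_le_card S x : (below S x <= #|S|)%N.
Proof. by apply/subset_leq_card/subsetP => y; rewrite inE => /andP[]. Qed.

Lemma below_lt S x : x \in S -> (below S x < #|S|)%N.
Proof.
move=> xS; apply: proper_card; apply/properP; split.
  by apply/subsetP => y; rewrite inE => /andP[].
by exists x => //; rewrite inE ltnn andbF.
Qed.

Lemma below_mono S x y : x \in S -> (x < y)%N -> (below S x < below S y)%N.
Proof.
move=> xS xy; apply: proper_card; apply/properP; split.
  apply/subsetP => z; rewrite !inE => /andP[-> zx] /=; exact: ltn_trans zx xy.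
by exists x; rewrite !inE ?xS ?xy // ltnn andbF.
Qed.

Lemma below_inj S : {in S &, injective (below S)}.
Proof.
move=> x y xS yS bxy; apply: val_inj => /=.
case: (ltngtP x y) => // [/(below_mono xS)|/(below_mono yS)];
  by rewrite bxy ltnn.
Qed.

Lemma below_setU1 S x : below (x |: S) x = below S x.
Proof.
apply: eq_card => y; rewrite !inE.
by have [->|] := eqVneq y x; rewrite ?ltnn ?andbF.
Qed.

Lemma below_setD1 S x : below (S :\ x) x = below S x.
Proof.
apply: eq_card => y; rewrite !inE.
by have [->|] := eqVneq y x; rewrite ?ltnn ?andbF.
Qed.

(** Removing x from S shifts the ranks of the other elements exactly as
    deleting column number [below S x] shifts the numbers of the other
    columns. *)
Lemma below_bump S x y : y \in S -> y != x -> x \in S ->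
  below S y = bump (below S x) (below (S :\ x) y).
Proof.
move=> yS yx xS; rewrite /bump.
have [lt_xy|le_yx] := ltnP x y.
  have Sy : below S y = (below (S :\ x) y).+1.
    rewrite /below (cardsD1 x) !inE xS lt_xy add1n; congr _.+1.
    by apply: eq_card => z; rewrite !inE; case: (z != x) => //=.
  have := below_mono xS lt_xy; rewrite Sy ltnS => ->.
  by rewrite add1n.
have lt_yx : (y < x)%N by rewrite ltn_neqAle le_yx andbT.
have Sy : below S y = below (S :\ x) y.
  apply: eq_card => z; rewrite !inE; case: eqVneq => //= ->.
  by rewrite ltnNge le_yx andbF.
by rewrite -Sy leqNgt below_mono.
Qed.

Lemma count_lt_index (s : seq 'I_n) x :
  sorted (fun y z : 'I_n => (y < z)%N) s -> x \in s ->
  count (fun y : 'I_n => (y < x)%N) s = index x s.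
Proof.
elim: s => //= y s IHs pys; rewrite inE.
have tr : transitive (fun y z : 'I_n => (y < z)%N).
  by move=> ? ? ?; apply: ltn_trans.
have all_y := order_path_min tr pys.
have [-> _|yx /= xs] := eqVneq x y.
  rewrite ltnn add0n; apply/eqP; rewrite -leqn0 leqNgt -has_count.
  by apply/negP => /hasP[z /(allP all_y) yz]; rewrite ltnNge ltnW.
by rewrite (allP all_y) // IHs ?(path_sorted pys) // eq_sym (negPf yx).
Qed.

Lemma sorted_enum S : sorted (fun y z : 'I_n => (y < z)%N) (enum S).
Proof.
rewrite {1}/enum_mem -enumT; apply: sorted_filter.
  by move=> ? ? ?; apply: ltn_trans.
have := iota_ltn_sorted 0 n; rewrite -val_enum_ord sorted_map.
exact: sub_sorted.
Qed.

Lemma below_enum_val S (j : 'I_#|S|) : below S (enum_val j) = j.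
Proof.
rewrite /below -sum1_card big_set /= -big_enum_cond sum1_count.
rewrite count_lt_index ?sorted_enum ?mem_enum ?enum_valP //.
by rewrite (enum_val_nth (enum_val j)) index_uniq ?enum_uniq // -cardE.
Qed.

End Rank.

Section PluckerRelations.
Variables (F : fieldType) (n : nat).
Implicit Types (A B I S : {set 'I_n}).

(** Modulo 2 the exponent of the sign is the number of elements of the
    symmetric difference of A and B that are smaller than x, since common
    elements count twice; this is the quantity that matchings control. *)
Definition plucker_relations k (p : {set 'I_n} -> F) : Prop :=
  forall A B, #|A|.+1 = k -> #|B| = k.+1 ->
  \sum_(x in B :\: A)
    (-1) ^+ (below A x + below B x) * (p (x |: A) * p (B :\ x)) = 0.

(** The sum has at most one term. Writing the column of rank c this way gives
    a matrix for every set I, with zero columns when I is too small. *)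
Definition sub_cols k (M : 'M[F]_(k, n)) I : 'M[F]_k :=
  \matrix_(r, c) \sum_(i in I | below I i == c) M r i.

Definition minor k (M : 'M[F]_(k, n)) I : F := \det (sub_cols M I).

Lemma sum_at_rank I x (f : 'I_n -> F) : x \in I ->
  \sum_(i in I | below I i == below I x) f i = f x.
Proof.
move=> xI; rewrite (big_pred1 x) // => i /=; apply/andP/eqP => [[iI /eqP]|->//].
exact: below_inj.
Qed.

(** For x outside A these are the columns of [x |: A], and for x in A the
    column of x occurs twice in a row; a single formula lets the expansion
    along the inserted column be uniform in x. *)
Definition insert_cols k (M : 'M[F]_(k, n)) A x : 'M[F]_k :=
  \matrix_(r, c) if c == below A x :> nat then M r x
    else \sum_(i in A | bump (below A x) (below A i) == c) M r i.

Lemma det_insert k (M : 'M[F]_(k, n)) A x : (below A x < k)%N ->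
  \det (insert_cols M A x) =
  \sum_(r < k) (-1) ^+ (r + below A x) * (M r x * minor (row' r M) A).
Proof.
move=> bk; rewrite (expand_det_col _ (Ordinal bk)); apply: eq_bigr => r _.
rewrite mxE eqxx mulrCA /cofactor /=; congr (_ * (_ * \det _)).
apply/matrixP => a c; rewrite !mxE /=.
rewrite eq_sym (negPf (neq_bump _ _)); apply: eq_big => i; rewrite ?mxE //.
by rewrite (inj_eq (can_inj (@bumpK _))).
Qed.

Lemma det_insert_notin k (M : 'M[F]_(k, n)) A x : x \notin A ->
  \det (insert_cols M A x) = minor M (x |: A).
Proof.
move=> xA; congr (\det _); apply/matrixP => r c; rewrite !mxE.
have [->|ne] := eqVneq (c : nat) (below A x).
  by rewrite -(below_setU1 A x) sum_at_rank // setU11.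
have xA1 : x \in x |: A by rewrite setU11.
apply: eq_bigl => i; rewrite !inE; have [->|ix] /= := eqVneq i x.
  by rewrite (negPf xA) below_setU1 [RHS]eq_sym (negPf ne).
case iA: (i \in A) => //=; rewrite (below_bump _ ix xA1) ?inE ?iA ?orbT //.
by rewrite below_setU1 setU1K.
Qed.

Lemma det_insert_in k (M : 'M[F]_(k, n)) A x : x \in A -> #|A|.+1 = k ->
  \det (insert_cols M A x) = 0.
Proof.
move=> xA Ak; have bk := below_lt xA.
have bk1 : (below A x < k)%N by rewrite -Ak ltnW.
have bk2 : ((below A x).+1 < k)%N by rewrite -Ak.
rewrite -det_tr; apply: (determinant_alternate (i1 := Ordinal bk1)
  (i2 := Ordinal bk2)); first by rewrite -val_eqE /= neq_ltn ltnSn.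
move=> r; rewrite !mxE eqxx /= gtn_eqF // (big_pred1 x) // => i /=.
apply/andP/eqP => [[iA]|->]; last by rewrite xA /bump leqnn.
rewrite /bump; case: leqP => [_|lt].
  by rewrite add1n eqSS => /eqP; apply: below_inj.
by rewrite add0n ltn_eqF // ltnW.
Qed.

Lemma minor_expand k (M : 'M[F]_(k, n)) A x : x \notin A -> (below A x < k)%N ->
  minor M (x |: A) =
  \sum_(r < k) (-1) ^+ (r + below A x) * (M r x * minor (row' r M) A).
Proof. by move=> xA bk; rewrite -det_insert_notin // det_insert. Qed.

(** This is the Laplace expansion along the first row of the minor at B of
    the matrix obtained from M by repeating row r on top. *)
Lemma sum_row_minor0 k (M : 'M[F]_(k, n)) B (r : 'I_k) : #|B| = k.+1 ->
  \sum_(x in B) (-1) ^+ below B x * (M r x * minor M (B :\ x)) = 0.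
Proof.
move=> Bk.
pose M' := \matrix_(i < k.+1, j < n)
  if unlift ord0 i is Some i' then M i' j else M r j.
have M'0 : minor M' B = 0.
  apply: (determinant_alternate (i1 := ord0) (i2 := lift ord0 r)) => //.
  move=> c; rewrite !mxE; apply: eq_bigr => i _.
  by rewrite !mxE unlift_none liftK.
rewrite -[RHS]M'0 /minor (expand_det_row _ ord0).
have bB x : x \in B -> (below B x < k.+1)%N by move=> /below_lt; rewrite Bk.
rewrite (partition_big (fun x => inord (below B x) : 'I_k.+1) predT) //=.
apply: eq_bigr => j _; rewrite mxE big_distrl /=; apply: eq_big => x.
  case xB: (x \in B) => //=; rewrite -val_eqE /= inordK //; exact: bB.
move=> /andP[xB /eqP <-]; rewrite !mxE unlift_none mulrCA; congr (_ * _).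
rewrite /cofactor add0n inordK ?bB //; congr (_ * \det _).
apply/matrixP => a c; rewrite !mxE; apply: eq_big => i.
  rewrite !inE /= inordK ?bB //.
  have [->|ix] /= := eqVneq i x; first by rewrite (negPf (neq_bump _ _)) andbF.
  case iB: (i \in B) => //=.
  by rewrite (below_bump iB ix xB) (inj_eq (can_inj (@bumpK _))).
by move=> _; rewrite mxE liftK.
Qed.

(** Expanding the factor at [x |: A] along the column of x makes it linear in
    that column, with coefficients that do not depend on x. The sum over x
    may be extended to all of B, since for x in A the inserted column is
    repeated. After exchanging the two sums, the inner one is
    [sum_row_minor0]. *)
Lemma plucker_minor k (M : 'M[F]_(k, n)) : plucker_relations k (minor M).
Proof.
move=> A B Ak Bk.
transitivity (\sum_(x in B) (-1) ^+ (below A x + below B x) *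
    (\det (insert_cols M A x) * minor M (B :\ x))).
  rewrite [RHS](bigID (mem A)) /= [X in _ = X + _]big1 ?add0r; last first.
    by move=> x /andP[_ xA]; rewrite det_insert_in // mul0r mulr0.
  apply: eq_big => x; first by rewrite inE andbC.
  by rewrite inE => /andP[xA _]; rewrite det_insert_notin.
have bA x : (below A x < k)%N.
  by apply: leq_ltn_trans (below_le_card _ _) _; rewrite Ak.
transitivity (\sum_(r < k) (-1) ^+ r * minor (row' r M) A *
   \sum_(x in B) (-1) ^+ below B x * (M r x * minor M (B :\ x))); last first.
  by apply: big1 => r _; rewrite sum_row_minor0 // mulr0.
under [RHS]eq_bigr do rewrite big_distrr /=.
rewrite exchange_big /=; apply: eq_bigr => x xB.
rewrite det_insert // big_distrl big_distrr /=; apply: eq_bigr => r _.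
rewrite !exprD; have := sqrr_sign F (odd (below A x)).
rewrite signr_odd expr2 => E.
set a := (-1) ^+ below A x in E *.
rewrite -[LHS]mulr1 -[RHS]mulr1.
transitivity ((-1) ^+ r * minor (row' r M) A *
  ((-1) ^+ below B x * (M r x * minor M (B :\ x))) * (a * a)).
  by ring.
by rewrite E.
Qed.

(** Induction on the number of elements of I outside I0. For i in I0 but not
    in I, the relation for [I0 :\ i] and [i |: I] contains the term p I0 * p
    I; every other term is the product of the value at a set that differs
    from I0 in one element and the value at a set closer to I0 than I. *)
Lemma plucker_unique k (p q : {set 'I_n} -> F) I0 :
  plucker_relations k p -> plucker_relations k q ->
  #|I0| = k -> p I0 != 0 -> p I0 = q I0 ->
  (forall i c, i \in I0 -> c \notin I0 -> p (c |: I0 :\ i) = q (c |: I0 :\ i)) ->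
  forall I, #|I| = k -> p I = q I.
Proof.
move=> Pp Pq I0k p0 pq0 pq1 I; have [m] := ubnP #|I :\: I0|.
elim: m I => // m IHm I; rewrite ltnS => Im Ik.
have [sII0|/subsetPn[i iI0 iI]] := boolP (I0 \subset I).
  by have -> : I = I0 by apply/esym/eqP; rewrite eqEcard sII0 Ik I0k leqnn.
have Ak : #|I0 :\ i|.+1 = k by rewrite -I0k (cardsD1 i I0) iI0.
have Bk : #|i |: I| = k.+1 by rewrite cardsU1 iI Ik.
have iBA : i \in (i |: I) :\: (I0 :\ i) by rewrite !inE eqxx.
have IK : (i |: I) :\ i = I by rewrite setU1K.
have I0K : i |: (I0 :\ i) = I0 by rewrite setD1K.
have := Pp _ _ Ak Bk; rewrite (bigD1 i) //= IK I0K.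
have := Pq _ _ Ak Bk; rewrite (bigD1 i) //= IK I0K.
set sq := \sum_(x | _) _; set sp := \sum_(x | _) _.
have -> : sq = sp; last first.
  rewrite -pq0 => <- /addIr /(can_inj (signrMK _)) /mulfI E; exact: E.
apply: eq_bigr => x; rewrite !inE => /andP[/andP[xA /orP[/eqP->|xI]] xi].
  by rewrite eqxx in xi.
move: xA; rewrite xi /= => xI0; rewrite pq1 // IHm //.
  have /subset_leq_card : ((i |: I) :\ x) :\: I0 \subset (I :\: I0) :\ x.
    apply/subsetP => y; rewrite !inE.
    case: (eqVneq y i) => [->|_] /=; first by rewrite iI0.
    by rewrite andbCA.
  move/leq_ltn_trans; apply.
  by apply: leq_trans Im; rewrite (cardsD1 x (I :\: I0)) !inE xI xI0.
have := Bk; rewrite (cardsD1 x (i |: I)) !inE xI orbT.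
by rewrite add1n => -[].
Qed.

Lemma below_ksubset_col k (I : ksubset k n) c : below (val I) (ksubset_col I c) = c.
Proof. by rewrite /ksubset_col below_enum_val. Qed.

Lemma ksubset_col_in k (I : ksubset k n) c : ksubset_col I c \in val I.
Proof. exact: enum_valP. Qed.

Lemma kminorE k (M : 'M[F]_(k, n)) (I : ksubset k n) : kminor M I = minor M (val I).
Proof.
congr (\det _); apply/matrixP => r c; rewrite !mxE.
by rewrite -(below_ksubset_col I c) sum_at_rank ?ksubset_col_in.
Qed.

Section Chart.
Variables (k : nat) (p : {set 'I_n} -> F) (I0 : ksubset k n).
Let e r := ksubset_col I0 r.

(** The matrix of the point in the affine chart p I0 <> 0: the identity in
    the columns of I0, and in column c and row r the coordinate of the set
    obtained from I0 by replacing its element of rank r by c, with the sign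
    of that position. *)
Definition chart_mx : 'M[F]_(k, n) :=
  \matrix_(r, c) if c \in val I0 :\ e r then 0 else
    (-1) ^+ (r + below (val I0 :\ e r) c) * (p (c |: val I0 :\ e r) / p (val I0)).

(** In the expansion along column c only row r contributes: deleting any
    other row keeps row r, which vanishes on the remaining columns, those of
    I0 without its element of rank r. *)
Lemma minor_chart r c : p (val I0) != 0 -> c \notin val I0 :\ e r ->
  minor chart_mx (c |: val I0 :\ e r) = p (c |: val I0 :\ e r) / p (val I0).
Proof.
move=> p0 cI.
have eI s : e s \in val I0 := ksubset_col_in I0 s.
have e_inj : injective e by move=> s t /(congr1 (below (val I0)));
  rewrite !below_ksubset_col => /val_inj.
have Ak : #|val I0 :\ e r|.+1 = k.
  by have := eqP (valP I0); rewrite (cardsD1 (e r)) eI.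
have bk : (below (val I0 :\ e r) c < k)%N.
  by apply: leq_ltn_trans (below_le_card _ _) _; rewrite Ak.
have D s t : chart_mx s (e t) = (s == t)%:R.
  rewrite mxE !inE eI andbT (inj_eq e_inj) eq_sym.
  have [->|//] := eqVneq s t.
  rewrite setD1K // divff // mulr1 below_setD1 below_ksubset_col.
  by rewrite addnn -muln2 exprM sqrr_sign.
have cols r' a (d : 'I_k.-1) :
    sub_cols (row' r' chart_mx) (val I0 :\ e r) a d = (lift r' a == lift r d)%:R.
  rewrite mxE -D (big_pred1 (e (lift r d))) ?mxE // => i /=.
  have ed : e (lift r d) \in val I0 :\ e r.
    by rewrite !inE eI andbT (inj_eq e_inj) eq_sym neq_lift.
  have bd : below (val I0 :\ e r) (e (lift r d)) = d.
    apply: (can_inj (bumpK (below (val I0) (e r)))).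
    rewrite -below_bump ?eI //; last by move: ed; rewrite !inE => /andP[].
    by rewrite !below_ksubset_col.
  apply/andP/eqP => [[iI /eqP]|->]; last by rewrite ed bd.
  by rewrite -bd; apply: below_inj.
rewrite minor_expand // (bigD1 r) //= big1 ?addr0.
  have -> : minor (row' r chart_mx) (val I0 :\ e r) = 1.
    rewrite -(det1 F k.-1); congr (\det _); apply/matrixP => a d.
    by rewrite cols mxE (inj_eq (@lift_inj _ _)).
  by rewrite mulr1 mxE (negPf cI) mulrA -exprD addnn -muln2 exprM sqrr_sign mul1r.
move=> r' r'r.
suff -> : minor (row' r' chart_mx) (val I0 :\ e r) = 0 by rewrite !mulr0.
have [a ra] : exists a, r = lift r' a.
  by have [a ->|E] := unliftP r' r; [exists a|rewrite E eqxx in r'r].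
rewrite /minor (expand_det_row _ a) big1 // => d _.
by rewrite cols -ra (negPf (neq_lift _ _)) mul0r.
Qed.

End Chart.

Lemma row_span_dim k (M : 'M[F]_(k, n)) : \rank M = k -> \dim (row_span M) = k.
Proof.
move=> Mk.
pose X := [tuple row i M | i < k].
have -> : row_span M = <<X>>%VS by rewrite /row_span /= -val_ord_tuple.
suff /eqP -> : free X by rewrite size_tuple.
apply/freeP => c; under eq_bigr do rewrite -tnth_nth tnth_mktuple.
move=> E i; have /eqP : \row_j c j *m M = 0.
  by rewrite mulmx_sum_row -[RHS]E; apply: eq_bigr => j _; rewrite mxE.
rewrite mulmx_free_eq0 /row_free ?Mk // => /eqP/matrixP/(_ ord0 i).
by rewrite !mxE.
Qed.

Lemma kminor_rank k (M : 'M[F]_(k, n)) (I : ksubset k n) :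
  kminor M I != 0 -> \rank M = k.
Proof.
rewrite -unitfE -unitmxE => /mxrank_unit rk; apply/eqP.
rewrite eqn_leq rank_leq_row -{1}rk -mxrank_tr -[\rank M]mxrank_tr.
by rewrite trmx_mxsub rowsubE mxrankM_maxr.
Qed.

(** By [plucker_unique] the function p / p I0 coincides with the minors of
    [chart_mx]. *)
Theorem plucker_point k (p : {set 'I_n} -> F) (I0 : ksubset k n) :
  plucker_relations k p -> p (val I0) != 0 ->
  exists X : Gr F k n, plucker_coordinates X (fun I : ksubset k n => p (val I)).
Proof.
move=> Pp p0; pose M := chart_mx p I0.
have I0k := eqP (valP I0).
have pM I : #|I| = k -> p I / p (val I0) = minor M I.
  apply: (@plucker_unique k (fun J => p J / p (val I0)) (minor M) (val I0)) => //.
  - move=> A B Ak Bk.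
    under eq_bigr do rewrite mulrACA -invfM mulrA.
    by rewrite -big_distrl /= Pp // mul0r.
  - exact: plucker_minor.
  - by rewrite divff ?oner_neq0.
  - rewrite divff //; case: (posnP k) => [k0|kp].
      by rewrite /minor; move: (sub_cols M _); rewrite k0 => D; rewrite det_mx00.
    have := @minor_chart k p I0 (Ordinal kp) (ksubset_col I0 (Ordinal kp)) p0.
    by rewrite setD1K ?ksubset_col_in // divff // !inE eqxx => ->.
  - move=> i c iI0 cI0; have [r ->] : exists r, i = ksubset_col I0 r.
      have lti : (below (val I0) i < k)%N by have := below_lt iI0; rewrite I0k.
      exists (Ordinal lti); apply: (@below_inj _ (val I0)) => //.
        exact: ksubset_col_in.
      by rewrite below_ksubset_col.
    by rewrite minor_chart // inE negb_and cI0 orbT.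
have rkM : \rank M = k.
  by apply: (@kminor_rank _ _ I0); rewrite kminorE -pM // divff ?oner_neq0.
exists (exist _ (row_span M) (introT eqP (row_span_dim rkM))), M; split=> //.
exists (p (val I0))^-1; rewrite ?invr_neq0 // => I.
by rewrite kminorE -pM ?(eqP (valP I)) // mulrC.
Qed.

End PluckerRelations.

(** * A planar Poincare-Miranda theorem *)

Lemma telescope_addb (f : nat -> bool) m :
  \big[addb/false]_(i < m) (f i (+) f i.+1) = f 0%N (+) f m.
Proof.
elim: m => [|m IHm]; first by rewrite big_ord0 addbb.
by rewrite big_ord_recr IHm /= addbA addbK.
Qed.

Definition corner (P : nat -> nat -> bool) i j : bool :=
  [|| P i j, P i.+1 j, P i j.+1 | P i.+1 j.+1].

(** A discrete form of the Poincare-Miranda theorem, by parity. Mark the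
    sides of cells at both ends of which u holds and across which w changes.
    A cell with an odd number of marked sides is mixed for u and for w. In
    the sum over all cells the inner sides cancel, and among the outer sides
    only those where u holds throughout can be marked; w changes an odd
    number of times along them. *)
Lemma mixed_cell m (u w : nat -> nat -> bool) :
  (forall j, (j <= m)%N -> ~~ u 0%N j) -> (forall j, (j <= m)%N -> u m j) ->
  (forall i, (i <= m)%N -> ~~ w i 0%N) -> (forall i, (i <= m)%N -> w i m) ->
  exists i j, [/\ (i < m)%N, (j < m)%N, corner u i j /\ corner (fun a b => ~~ u a b) i j
    & corner w i j /\ corner (fun a b => ~~ w a b) i j].
Proof.
move=> u0 u1 w0 w1.
pose h i j := [&& u i j, u i.+1 j & w i j (+) w i.+1 j].
pose v i j := [&& u i j, u i j.+1 & w i j (+) w i j.+1].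
have [[i [j P]]|noP] := pselect (exists i j : 'I_m,
    (h i j (+) h i j.+1) (+) (v i j (+) v i.+1 j)).
  exists i, j; split; rewrite ?ltn_ord //; move: P; rewrite /h /v /corner.
    by case: (u i j) (u i.+1 j) (u i j.+1) (u i.+1 j.+1) (w i j) (w i.+1 j)
      (w i j.+1) (w i.+1 j.+1) => [] [] [] [] [] [] [] [].
  by case: (u i j) (u i.+1 j) (u i j.+1) (u i.+1 j.+1) (w i j) (w i.+1 j)
      (w i j.+1) (w i.+1 j.+1) => [] [] [] [] [] [] [] [].
have : \big[addb/false]_(i < m) \big[addb/false]_(j < m)
    ((h i j (+) h i j.+1) (+) (v i j (+) v i.+1 j)) = false.
  rewrite big1 // => i _; rewrite big1 // => j _; apply/negbTE/negP => P.
  by apply: noP; exists i, j.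
under eq_bigr do rewrite big_split /=.
rewrite big_split /= [X in _ (+) X]exchange_big /=.
under eq_bigr do rewrite telescope_addb.
under [X in _ (+) X]eq_bigr => j _ do
  rewrite (telescope_addb (fun i => v i j)).
rewrite big1 ?addFb; last first.
  move=> i _; rewrite /h (negPf (w0 _ _)) ?(negPf (w0 _ _)) ?w1 ?andbF //;
    exact: ltnW.
rewrite (eq_bigr (fun j : 'I_m => w m j (+) w m j.+1)); last first.
  move=> j _; have jm := ltnW (ltn_ord j).
  by rewrite /v (negPf (u0 _ _)) // !u1.
by rewrite telescope_addb (negPf (w0 _ _)) // w1.
Qed.

Section Miranda.
Variable R : realType.

Definition unit_square : set (R * R) := (`[0, 1] `*` `[0, 1])%classic.

Lemma corner_close (m i j : nat) (P : R -> R -> bool) :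
  corner (fun a b => P (a%:R / m.+1%:R) (b%:R / m.+1%:R)) i j ->
  exists z : R * R, P z.1 z.2 /\
    ball ((i%:R / m.+1%:R, j%:R / m.+1%:R) : R * R) (2 * m.+1%:R^-1) z.
Proof.
have m0 : 0 < m.+1%:R^-1 :> R by rewrite invr_gt0 ltr0n.
have step (a : nat) (b : bool) :
    ball (a%:R / m.+1%:R : R) (2 * m.+1%:R^-1) ((b + a)%:R / m.+1%:R).
  rewrite /ball /= -mulrBl natrD opprD addrCA subrr addr0 normrM normrN.
  rewrite !ger0_norm ?ler0n ?(ltW m0) // ltr_pM2r //.
  by case: b; rewrite ?ltr1n ?ltr0n.
case/or4P => Pij.
- exists (i%:R / m.+1%:R, j%:R / m.+1%:R); split=> //.
  by split=> /=; exact: (step _ false).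
- exists (i.+1%:R / m.+1%:R, j%:R / m.+1%:R); split=> //.
  by split=> /=; [exact: (step _ true)|exact: (step _ false)].
- exists (i%:R / m.+1%:R, j.+1%:R / m.+1%:R); split=> //.
  by split=> /=; [exact: (step _ false)|exact: (step _ true)].
- exists (i.+1%:R / m.+1%:R, j.+1%:R / m.+1%:R); split=> //.
  by split=> /=; exact: (step _ true).
Qed.

Definition sign_changes_near (F : R * R -> R) (m : nat) (z : R * R) :=
  exists z1 z2, [/\ ball z (2 * m.+1%:R^-1) z1, ball z (2 * m.+1%:R^-1) z2,
    0 < F z1 & F z2 <= 0].

(** If F z were positive, F would be positive on a ball around z, which
    contains all points near u m for some large m; likewise if F z were
    negative. *)
Lemma cluster_zero (F : R * R -> R) (u : nat -> R * R) z :
  continuous F -> (forall m, sign_changes_near F m (u m)) ->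
  cluster (u @ \oo)%classic z -> F z = 0.
Proof.
move=> Fc Fu uz.
have near_sign (P : set R) : (nbhs (F z) P)%classic ->
    exists m, forall w, ball (u m) (2 * m.+1%:R^-1) w -> P (F w).
  move=> /Fc /nbhs_ballP[r /= r0 rP].
  have r2 : 0 < r / 2 by lra.
  have r4 : 0 < r / 4 by lra.
  have [N _ HN] := near_infty_natSinv_lt (PosNum r4).
  have tail : (u @ \oo)%classic (u @` [set m | (N <= m)%N])%classic.
    by exists N => // m Nm; exists m.
  have [w [[m Nm <-] zw]] := uz _ _ tail (nbhsx_ballx z _ r2).
  exists m => w' uw; apply: rP; apply: (ball_split zw).
  by apply: le_ball uw; move: (HN m Nm) => /=; move: (_^-1) => e; lra.
have [Fz|Fz|//] := ltgtP (F z) 0.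
  have [m Hm] := near_sign _ (lt_nbhsl Fz).
  have [z1 [_ [b1 _ Fz1 _]]] := Fu m.
  by have := lt_trans (Hm _ b1) Fz1; rewrite ltxx.
have [m Hm] := near_sign _ (lt_nbhsr Fz).
have [_ [z2 [_ b2 _ Fz2]]] := Fu m.
by have := lt_le_trans (Hm _ b2) Fz2; rewrite ltxx.
Qed.

(** Grids of finer and finer mesh contain cells on which both functions
    change sign, and these cells accumulate at a common zero by compactness. *)
Lemma poincare_miranda (F1 F2 : R * R -> R) :
  continuous F1 -> continuous F2 ->
  (forall t, 0 <= t <= 1 -> F1 (0, t) <= 0) ->
  (forall t, 0 <= t <= 1 -> 0 < F1 (1, t)) ->
  (forall s, 0 <= s <= 1 -> F2 (s, 0) <= 0) ->
  (forall s, 0 <= s <= 1 -> 0 < F2 (s, 1)) ->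
  exists s t, [/\ 0 <= s <= 1, 0 <= t <= 1, F1 (s, t) = 0 & F2 (s, t) = 0].
Proof.
move=> F1c F2c F10 F11 F20 F21.
have frac m i : (i <= m.+1)%N -> 0 <= (i%:R / m.+1%:R : R) <= 1.
  by move=> im; rewrite divr_ge0 //= ler_pdivrMr ?ltr0n // mul1r ler_nat.
have cell m : exists z,
    [/\ unit_square z, sign_changes_near F1 m z & sign_changes_near F2 m z].
  pose f i : R := i%:R / m.+1%:R.
  have f0 : f 0%N = 0 by rewrite /f mul0r.
  have f1 : f m.+1 = 1 by rewrite /f divff // pnatr_eq0.
  have [|||| i [j [im jm [c1 c2] [c3 c4]]]] := @mixed_cell m.+1
    (fun i j => 0 < F1 (f i, f j)) (fun i j => 0 < F2 (f i, f j)).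
  - by move=> j jm; rewrite f0 -leNgt F10 // frac.
  - by move=> j jm; rewrite f1 F11 // frac.
  - by move=> j jm; rewrite f0 -leNgt F20 // frac.
  - by move=> j jm; rewrite f1 F21 // frac.
  exists (f i, f j); split.
  - by split; rewrite /= in_itv /= frac // ltnW.
  - have [z1 [p1 b1]] := corner_close (P := fun a b => 0 < F1 (a, b)) c1.
    have [z2 [p2 b2]] := corner_close (P := fun a b => ~~ (0 < F1 (a, b))) c2.
    by exists z1, z2; split; rewrite // -?leNgt -?surjective_pairing in p1 p2 *.
  - have [z1 [p1 b1]] := corner_close (P := fun a b => 0 < F2 (a, b)) c3.
    have [z2 [p2 b2]] := corner_close (P := fun a b => ~~ (0 < F2 (a, b))) c4.
    by exists z1, z2; split; rewrite // -?leNgt -?surjective_pairing in p1 p2 *.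
have [u Hu] := choice cell.
have K : compact unit_square by apply: compact_setX; apply: segment_compact.
have [z [[z1 z2] uz]] : (unit_square `&` cluster (u @ \oo) !=set0)%classic.
  by apply: K; exists 0%N => // m _; case: (Hu m).
exists z.1, z.2; rewrite -surjective_pairing.
move: z1 z2; rewrite /= !in_itv /= => -> ->; split=> //.
- by apply: cluster_zero F1c _ uz => m; case: (Hu m).
- by apply: cluster_zero F2c _ uz => m; case: (Hu m).
Qed.
End Miranda.

(** * Curves with interlaced ends in the disk meet *)

Section Crossing.
Variable R : realType.
Implicit Types (a b c d p q x : R * R).

Definition disk : set (R * R) := [set p | p.1 ^+ 2 + p.2 ^+ 2 <= 1]%classic.

Definition circle_pt (t : R) : R * R := (cos t, sin t).

(** Twice the signed area of the triangle a b c. *)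
Definition orient a b c : R :=
  (b.1 - a.1) * (c.2 - a.2) - (b.2 - a.2) * (c.1 - a.1).

(** The orientation is -4 times the product of the sines of half the differences
    of the angles, and these halves lie between 0 and pi. *)
Lemma orient_circle (s t u : R) : s > t -> t > u -> u > s - 2 * pi ->
  orient (circle_pt s) (circle_pt t) (circle_pt u) < 0.
Proof.
move=> st tu us; have pi0 := pi_gt0 R.
pose x := (s - t) / 2; pose y := (t - u) / 2.
have -> : orient (circle_pt s) (circle_pt t) (circle_pt u) =
    - (4 * (sin x * sin y * sin (x + y))).
  transitivity (sin (x + x + (y + y)) - sin (x + x) - sin (y + y)).
    have -> : x + x + (y + y) = s - u by rewrite /x /y; field.
    have -> : x + x = s - t by rewrite /x; field.
    have -> : y + y = t - u by rewrite /y; field.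
    by rewrite !sinB /orient /=; ring.
  have cos2x z : cos (z + z) = 1 - 2 * sin z ^+ 2 :> R.
    by rewrite cosD -expr2 cos2sin2; ring.
  by rewrite sinD !cos2x !sinD; ring.
rewrite oppr_lt0 !mulr_gt0 // sin_gt0_pi //; rewrite /x /y; lra.
Qed.

(** For a on the unit circle, the affine function that vanishes on the
    tangent line at a and equals 1 at the center; it is positive on the
    closed disk except at a. *)
Definition tangent a x : R := 1 - a.1 * x.1 - a.2 * x.2.

(** Twice the tangent function at x is the sum of the squared distance from a to
    x and of 1 minus the squared norm of x. *)
Lemma tangent_ge0 (t : R) x : disk x -> 0 <= tangent (circle_pt t) x.
Proof.
rewrite /disk /tangent /= => dx; have := cos2Dsin2 t.
have := sqr_ge0 (cos t - x.1); have := sqr_ge0 (sin t - x.2).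
by nra.
Qed.

Lemma tangent_gt0 (t : R) x : disk x -> x <> circle_pt t ->
  0 < tangent (circle_pt t) x.
Proof.
move=> dx xt; rewrite lt0r tangent_ge0 // andbT; apply: contra_notN xt => /eqP T0.
have : (cos t - x.1) ^+ 2 + (sin t - x.2) ^+ 2 <= 0.
  by move: T0 dx (cos2Dsin2 t); rewrite /disk /tangent /=; nra.
rewrite le_eqVlt ltNge addr_ge0 ?sqr_ge0 ?orbF //.
rewrite paddr_eq0 ?sqr_ge0 // !sqrf_eq0 !subr_eq0 => /andP[/eqP cx /eqP sx].
by rewrite /circle_pt cx sx -surjective_pairing.
Qed.

(** The four affine functions satisfy one linear relation: [bcd] ta + [abd]
    tc = [acd] tb + [abc] td, with orientations as coefficients. Let h be the
    common value, which does not vanish at p and q. The first proportion says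
    that ta and tc both scale by h q / h p from p to q, the second says the
    same of tb and td. Three of these functions are linearly independent, so
    homogeneous coordinates of p and q are proportional and p = q. *)
Lemma tangent_pencils a b c d p q :
  orient a b c < 0 -> orient a b d < 0 -> orient a c d < 0 -> orient b c d < 0 ->
  0 <= tangent a p -> 0 <= tangent c p -> 0 < tangent a p + tangent c p ->
  0 <= tangent a q -> 0 <= tangent c q -> 0 < tangent a q + tangent c q ->
  tangent a p * tangent c q = tangent c p * tangent a q ->
  tangent b p * tangent d q = tangent d p * tangent b q -> p = q.
Proof.
move=> abc abd acd bcd ap cp acp aq cq acq E1 E2.
pose h x := orient b c d * tangent a x + orient a b d * tangent c x.
have hE x : h x = orient a c d * tangent b x + orient a b c * tangent d x.
  by rewrite /h /orient /tangent; ring.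
have h_lt0 x : 0 <= tangent a x -> 0 <= tangent c x ->
    0 < tangent a x + tangent c x -> h x < 0.
  rewrite /h => A0 C0 AC; have [A1|A1] := ltP 0 (tangent a x).
    have : orient b c d * tangent a x < 0 by rewrite nmulr_rlt0.
    have : orient a b d * tangent c x <= 0 by rewrite nmulr_rle0.
    by lra.
  have : orient b c d * tangent a x <= 0 by rewrite nmulr_rle0.
  have : orient a b d * tangent c x < 0 by rewrite nmulr_rlt0 //; lra.
  by lra.
have hp := h_lt0 p ap cp acp; have hq := h_lt0 q aq cq acq.
have Ea : tangent a q * h p = tangent a p * h q.
  apply/eqP; rewrite -subr_eq0 /h; apply/eqP.
  transitivity (orient a b d * (tangent c p * tangent a q - tangent a p * tangent c q));
    last by rewrite E1 subrr mulr0.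
  by ring.
have Ec : tangent c q * h p = tangent c p * h q.
  apply/eqP; rewrite -subr_eq0 /h; apply/eqP.
  transitivity (orient b c d * (tangent a p * tangent c q - tangent c p * tangent a q));
    last by rewrite E1 subrr mulr0.
  by ring.
have Eb : tangent b q * h p = tangent b p * h q.
  apply/eqP; rewrite -subr_eq0 !hE; apply/eqP.
  transitivity (orient a b c * (tangent d p * tangent b q - tangent b p * tangent d q));
    last by rewrite E2 subrr mulr0.
  by ring.
pose w1 := h p * q.1 - h q * p.1; pose w2 := h p * q.2 - h q * p.2.
have Wab : (b.1 - a.1) * w1 + (b.2 - a.2) * w2 = 0.
  move: Ea Eb; rewrite /w1 /w2 /tangent.
  by move: (h p) (h q) => H K; lra.
have Wac : (c.1 - a.1) * w1 + (c.2 - a.2) * w2 = 0.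
  move: Ea Ec; rewrite /w1 /w2 /tangent.
  by move: (h p) (h q) => H K; lra.
have orient0 : orient a b c != 0 by rewrite lt_eqF.
have w10 : w1 = 0.
  apply: (mulfI orient0); rewrite mulr0.
  transitivity (((b.1 - a.1) * w1 + (b.2 - a.2) * w2) * (c.2 - a.2) -
    ((c.1 - a.1) * w1 + (c.2 - a.2) * w2) * (b.2 - a.2)).
    by rewrite /orient; ring.
  by rewrite Wab Wac; ring.
have w20 : w2 = 0.
  apply: (mulfI orient0); rewrite mulr0.
  transitivity (((c.1 - a.1) * w1 + (c.2 - a.2) * w2) * (b.1 - a.1) -
    ((b.1 - a.1) * w1 + (b.2 - a.2) * w2) * (c.1 - a.1)).
    by rewrite /orient; ring.
  by rewrite Wab Wac; ring.
have hpq : h p = h q.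
  have : h p - h q = a.1 * w1 + a.2 * w2.
    by move: Ea; rewrite /w1 /w2 /tangent; move: (h p) (h q) => H K; lra.
  by rewrite w10 w20 !mulr0 addr0 => /eqP; rewrite subr_eq0 => /eqP.
have hq0 : h q != 0 by rewrite lt_eqF.
move: w10 w20; rewrite /w1 /w2 hpq -!mulrBr => /eqP + /eqP.
rewrite !mulf_eq0 (negPf hq0) /= !subr_eq0 => /eqP e1 /eqP e2.
by rewrite [p]surjective_pairing [q]surjective_pairing e1 e2.
Qed.

Lemma continuous_tangent a : continuous (tangent a).
Proof.
move=> x; rewrite /tangent; apply: cvgB; [apply: cvgB|].
- exact: cvg_cst.
- by apply: cvgMr; exact: cvg_fst.
- by apply: cvgMr; exact: cvg_snd.
Qed.

(** The functions F1 and F2 below vanish together only where the curves meet,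
    by [tangent_pencils]. Geometrically F1 compares the lines that join f s
    and g t to the pole of the chord t0 t2, and F2 does so for the chord t1
    t3. At an end of a curve one of the tangent functions vanishes, which
    gives the signs on the sides of the square that the Poincare-Miranda
    theorem asks for. *)
Theorem curves_cross (t0 t1 t2 t3 : R) (f g : R -> R * R) :
  t0 > t1 -> t1 > t2 -> t2 > t3 -> t3 > t0 - 2 * pi ->
  continuous f -> continuous g ->
  (forall s, disk (f s)) -> (forall t, disk (g t)) ->
  f 0 = circle_pt t0 -> f 1 = circle_pt t2 ->
  g 0 = circle_pt t1 -> g 1 = circle_pt t3 ->
  exists s t, f s = g t.
Proof.
move=> t01 t12 t23 t30 fc gc fd gd f0 f1 g0 g1.
have [//|disj] := pselect (exists s t, f s = g t); exfalso.
have {}disj s t : f s <> g t by move=> E; apply: disj; exists s, t.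
have := @tangent_pencils (circle_pt t0) (circle_pt t1) (circle_pt t2) (circle_pt t3).
set a := circle_pt t0 in f0 *; set b := circle_pt t1 in g0 *.
set c := circle_pt t2 in f1 *; set d := circle_pt t3 in g1 *.
have gt0 (t : R) x : disk x -> x <> circle_pt t -> 0 < tangent (circle_pt t) x
  := @tangent_gt0 t x.
have ge0 (t : R) x : disk x -> 0 <= tangent (circle_pt t) x := @tangent_ge0 t x.
move=> pencils.
pose F1 (z : R * R) := tangent a (f z.1) * tangent c (g z.2)
  - tangent c (f z.1) * tangent a (g z.2).
pose F2 (z : R * R) := tangent b (g z.2) * tangent d (f z.1)
  - tangent d (g z.2) * tangent b (f z.1).
have Oabc : orient a b c < 0 by apply: orient_circle; lra.
have Oabd : orient a b d < 0 by apply: orient_circle; lra.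
have Oacd : orient a c d < 0 by apply: orient_circle; lra.
have Obcd : orient b c d < 0 by apply: orient_circle; lra.
have ca : c <> a by move=> E; move: Oabc; rewrite E /orient; lra.
have db : d <> b by move=> E; move: Obcd; rewrite E /orient; lra.
have Db : disk b by rewrite -g0.
have dd : disk d by rewrite -g1.
have dc : disk c by rewrite -f1.
have da : disk a by rewrite -f0.
have sum_gt0 x : disk x -> 0 < tangent a x + tangent c x.
  move=> dx; have [->|xa] := eqVneq x a.
    by rewrite ltr_wpDl ?ge0 ?gt0 //; apply: nesym.
  by rewrite ltr_wpDr ?ge0 ?gt0 //; apply/eqP.
have cf x : continuous (fun z : R * R => tangent x (f z.1)).
  move=> z; apply: (@continuous_comp _ _ _ (fun z : R * R => f z.1) (tangent x)).
    by apply: (@continuous_comp _ _ _ fst f); [exact: cvg_fst|exact: fc].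
  exact: continuous_tangent.
have cg x : continuous (fun z : R * R => tangent x (g z.2)).
  move=> z; apply: (@continuous_comp _ _ _ (fun z : R * R => g z.2) (tangent x)).
    by apply: (@continuous_comp _ _ _ snd g); [exact: cvg_snd|exact: gc].
  exact: continuous_tangent.
have self (t : R) : tangent (circle_pt t) (circle_pt t) = 0.
  by rewrite /tangent /= -!expr2 -addrA -opprD cos2Dsin2 subrr.
have [|||||| s [t [_ _ Z1 Z2]]] := @poincare_miranda R F1 F2.
- by move=> z; apply: cvgB; apply: cvgM; [exact: cf|exact: cg|exact: cf|exact: cg].
- by move=> z; apply: cvgB; apply: cvgM; [exact: cg|exact: cf|exact: cg|exact: cf].
- move=> t _; rewrite /F1 /= f0 self mul0r sub0r oppr_le0 mulr_ge0 ?ge0 //.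
- move=> t _; rewrite /F1 /= f1 self mul0r subr0 mulr_gt0 ?gt0 //.
  by move=> E; apply: (disj 1 t); rewrite f1.
- move=> s _; rewrite /F2 /= g0 self mul0r sub0r oppr_le0 mulr_ge0 ?ge0 //.
- move=> s _; rewrite /F2 /= g1 self mul0r subr0 mulr_gt0 ?gt0 //.
  by move=> E; apply: (disj s 1); rewrite g1.
apply: (disj s t); apply: pencils; rewrite ?ge0 ?sum_gt0 //.
  by apply/eqP; rewrite -subr_eq0; apply/eqP.
by move: Z2; rewrite /F2 /=; lra.
Qed.
End Crossing.

Section Joined.
Variable R : realType.
Implicit Types (S : set (R * R)) (p q r : R * R).

(** The curve is defined on the whole line and constant outside the unit
    interval, so that curves can be concatenated by adding
    reparametrizations. *)
Definition joined S p q : Prop := exists f : R -> R * R,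
  [/\ continuous f, forall t, t <= 0 -> f t = p, forall t, 1 <= t -> f t = q
    & forall t, S (f t)].

Lemma joined_refl S p : S p -> joined S p p.
Proof. by move=> Sp; exists (fun=> p); split=> // t; exact: cvg_cst. Qed.

Lemma joined_sym S p q : joined S p q -> joined S q p.
Proof.
move=> [f [fc f0 f1 fS]]; exists (fun t : R => f (1 - t)); split=> [t|t t0|t t1|t].
- apply: (@continuous_comp _ _ _ (fun t : R => 1 - t) f); last exact: fc.
  by apply: cvgB; [exact: cvg_cst|exact: cvg_id].
- by rewrite f1 //; lra.
- by rewrite f0 //; lra.
- exact: fS.
Qed.

Lemma joined_trans S p q r : joined S p q -> joined S q r -> joined S p r.
Proof.
move=> [f [fc f0 f1 fS]] [g [gc g0 g1 gS]].
(* In the first half the term in g is constantly q, in the second half the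
   term in f is. *)
exists (fun t : R => f (2 * t) + g (2 * t - 1) - q); split=> [t|t t0|t t1|t].
- have c2 : continuous (fun t : R => 2 * t).
    by move=> u; apply: cvgMr; exact: cvg_id.
  apply: cvgB; last exact: cvg_cst.
  apply: cvgD.
    apply: (@continuous_comp _ _ _ (fun t : R => 2 * t) f); last exact: fc.
    exact: c2.
  apply: (@continuous_comp _ _ _ (fun t : R => 2 * t - 1) g); last exact: gc.
  by apply: cvgB; [exact: c2|exact: cvg_cst].
- by rewrite f0 ?g0 ?addrK //; lra.
- by rewrite f1 ?g1 ?[q + _]addrC ?addrK //; lra.
- have [t2|t2] := leP (2 * t) 1.
    by rewrite g0 ?addrK //; lra.
  by rewrite f1 ?[q + _]addrC ?addrK //; lra.
Qed.

Lemma joined_arc S (c : R -> R * R) :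
  {within `[0, 1], continuous c}%classic -> (forall t, t \in `[0, 1] -> S (c t)) ->
  joined S (c 0) (c 1).
Proof.
move=> cc cS; pose clamp t : R := Num.max 0 (Num.min t 1).
have clampI t : clamp t \in `[0, 1].
  by rewrite in_itv /= /clamp le_max lexx ge_max ler01 ge_min lexx orbT.
exists (c \o clamp); split=> [t|t t0|t t1|t] /=.
- have clampc : {for t, continuous clamp}.
    apply: continuous_max; first exact: cvg_cst.
    by apply: continuous_min; [exact: cvg_id|exact: cvg_cst].
  move/subspace_continuousP : cc => /(_ (clamp t) (clampI t)) cct.
  apply: cvg_comp cct => A; rewrite /within /= => /clampc wA.
  apply: (@filterS _ (nbhs t) _ _ _ _ wA) => u.
  by apply; exact: clampI.
- by congr c; rewrite /clamp (min_idPl _) ?(max_idPl _) //; lra.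
- by congr c; rewrite /clamp (min_idPr _) ?(max_idPr _) //; lra.
- exact/cS/clampI.
Qed.
End Joined.

(** * Paths of a pair of involutions *)

Section TwoInvolutions.
Local Open Scope nat_scope.
Variables (T : finType) (a b : T -> T).
Hypotheses (aK : involutive a) (bK : involutive b).

Definition link : rel T := fun u v => (a u == v) || (b u == v).

Definition ends x : {set T} :=
  [set v | connect link x v && ((a v == v) || (b v == v))].

Let rho := a \o b.
Let rho_inj : injective rho := inj_comp (inv_inj aK) (inv_inj bK).

Let rhoE u : rho u = a (b u). Proof. by []. Qed.

(** The involution a conjugates rho to its inverse; here and in [iter_rho_b]
    this is said without an inverse. *)
Lemma iter_rho_a j u : iter j rho (a (iter j rho u)) = a u.
Proof.
by elim: j => // j IHj; rewrite iterSr iterS !rhoE aK bK.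
Qed.

Lemma iter_rho_b j u : iter j.+1 rho (b (iter j rho u)) = a u.
Proof. by rewrite iterSr rhoE bK iter_rho_a. Qed.

Lemma iter_orderP x j : (iter j rho x == x) = (order rho x %| j).
Proof.
rewrite {1}(divn_eq j (order rho x)) addnC iterD.
have -> : iter (j %/ order rho x * order rho x) rho x = x.
  by elim: (j %/ _) => // q IHq; rewrite mulSn iterD IHq iter_order.
have jm : j %% order rho x < order rho x by rewrite ltn_mod order_gt0.
apply/eqP/eqP => [/(congr1 (findex rho x))|/eqP/eqP-> //].
by rewrite findex_iter // findex0.
Qed.

Variable x : T.
Hypotheses (ax : a x = x) (bx : b x != x).

Lemma connect_orbit v : connect link x v ->
  exists2 j, j < order rho x & v = iter j rho x.
Proof.
case/connectP => p + ->; have : fconnect rho x x by [].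
elim: p {2 3 5}x => [|w p IHp] u xu /=.
  by exists (findex rho x u); [exact: findex_max|rewrite iter_findex].
case/andP => uw; apply: IHp; set j := findex rho x u.
have Eu : u = iter j rho x by rewrite iter_findex.
rewrite fconnect_sym //; move: uw; rewrite Eu; case/orP => /eqP <-.
  by have := fconnect_iter rho j (a (iter j rho x)); rewrite iter_rho_a ax.
by have := fconnect_iter rho j.+1 (b (iter j rho x)); rewrite iter_rho_b ax.
Qed.

Lemma orbit_connect j : connect link x (iter j rho x).
Proof.
elim: j => [|j IHj]; first exact: connect0.
apply: connect_trans IHj _; rewrite iterS rhoE.
apply: (@connect_trans _ _ (b (iter j rho x))); apply: connect1.
  by rewrite /link eqxx orbT.
by rewrite /link eqxx.
Qed.

(** The component of x is the orbit of x under rho. If m is its length, then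
    a maps rho^j x to rho^(-j) x and b maps it to rho^(-j-1) x. So the fixed
    points in the orbit are given by 2j = 0 or 2j + 1 = 0 modulo m, that is,
    by j = 0 and j = m/2 rounded down. *)
Lemma two_ends : exists2 y, y != x & ends x = [set x; y].
Proof.
pose m := order rho x.
have m2 : 1 < m.
  rewrite ltn_neqAle order_gt0 andbT eq_sym; apply: contra bx => /eqP m1.
  have : iter 1 rho x == x by rewrite iter_orderP -/m m1.
  by rewrite /= rhoE (can2_eq aK aK) ax.
have iinj j : injective (iter j rho).
  by elim: j => [|j IHj] // u v /rho_inj /IHj.
have fixa j : (a (iter j rho x) == iter j rho x) = (m %| j + j).
  by rewrite -iter_orderP iterD -[LHS](inj_eq (iinj j)) iter_rho_a ax eq_sym.
have fixb j : (b (iter j rho x) == iter j rho x) = (m %| j.+1 + j).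
  by rewrite -iter_orderP iterD -[LHS](inj_eq (iinj j.+1)) iter_rho_b ax eq_sym.
have h0 : 0 < m./2 < m by lia.
exists (iter m./2 rho x).
  rewrite iter_orderP -/m; apply/negP => /dvdn_leq; lia.
apply/setP => v; rewrite !inE; apply/andP/orP => [[/connect_orbit[j jm ->]]|].
  rewrite fixa fixb => mj.
  have [->|j0] := eqVneq j 0; first by left.
  right; apply/eqP; congr (iter _ rho x).
  case/orP: mj => /dvdnP[q Eq].
    have : q = 1 by nia.
    by lia.
  have : q = 1 by nia.
  by lia.
case=> /eqP ->; first by rewrite connect0 ax eqxx.
rewrite orbit_connect fixa fixb; split=> //.
have [om|em] := boolP (odd m).
  by apply/orP; right; rewrite (_ : _ + _ = m) //; lia.
by apply/orP; left; rewrite (_ : _ + _ = m) //; lia.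
Qed.
End TwoInvolutions.

(** * Superposed almost perfect matchings *)

Section Matchings.
Variables (R : realType) (n : nat) (N : network R n).
Local Notation V := ('I_n + ivert N)%type.
Implicit Types (P Q U : {set edge N}) (C : {set V}) (e : edge N) (u v w : V) (i : 'I_n).

Lemma ends_neq e : black_end e != white_end e.
Proof.
by apply/eqP => E; have := white_endP e; rewrite -E black_endP.
Qed.

Lemma incident_black e v : is_black v -> incident e v = (black_end e == v).
Proof.
move=> bv; rewrite /incident orbC; case: eqP => // E.
by have := white_endP e; rewrite E bv.
Qed.

Lemma incident_white e v : ~~ is_black v -> incident e v = (white_end e == v).
Proof.
move=> wv; rewrite /incident; case: eqP => // E.
by have := black_endP e; rewrite E (negPf wv).
Qed.

(** Every edge has one end of each color, so that sending an edge to its end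
    of color c counts the vertices of color c that the matching uses. *)
Lemma card_matching_by_end P (c : bool) (f : edge N -> V) :
  almost_perfect P -> (forall e, is_black (f e) = c) ->
  (forall e v, is_black v = c -> incident e v = (f e == v)) ->
  #|P| = (#|[set v : ivert N | is_black (inr v : V) == c]|
    + #|[set i : 'I_n | (is_black (inl i : V) == c) && bd_used P i]|)%N.
Proof.
move=> /forallP ap fc fi.
rewrite -sum1_card (partition_big f predT) //= big_sumType /= addnC.
have inc v : is_black v = c ->
    (\sum_(e in P | f e == v) 1)%N = #|[set e in P | incident e v]|.
  by move=> vc; rewrite sum1_card; apply: eq_card => e; rewrite !inE fi.
have none v : is_black v != c -> (\sum_(e in P | f e == v) 1)%N = 0%N.
  move=> vc; rewrite big1 // => e /andP[_ /eqP fe].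
  by move: vc; rewrite -fe fc eqxx.
congr (_ + _)%N.
  rewrite -sum1_card [RHS]big_mkcond; apply: eq_bigr => v _; rewrite inE.
  by case: eqP => [/inc ->|/eqP /none //]; apply/eqP; exact: ap.
rewrite -sum1_card [RHS]big_mkcond; apply: eq_bigr => i _; rewrite inE.
case: eqP => [ic|/eqP /none //] /=; rewrite inc //.
case: ifP => [/existsP[e /andP[eP ei]]|/negbT/existsPn nu].
  apply/eqP; rewrite eqn_leq; apply/andP; split; last first.
    by apply/card_gt0P; exists e; rewrite inE eP.
  rewrite -(@boundary_deg1 _ _ N i).
  by apply/subset_leq_card/subsetP => e'; rewrite !inE => /andP[].
apply: eq_card0 => e; rewrite !inE; apply/negbTE; exact: nu.
Qed.

(** The neighbor of a white boundary vertex is black, and it is an interior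
    vertex. *)
Lemma net_d'E : net_d' N = #|[set i : 'I_n | ~~ is_black (inl i : V)]|.
Proof.
apply: eq_card => i; rewrite !inE; apply/existsP/idP => [[e /existsP[v]]|wi].
  case/and3P => ei ev bv; apply/negP => bi.
  by move: ei ev; rewrite !incident_black // => /eqP ->.
have /eqP/cards1P[e eE] := @boundary_deg1 _ _ N i.
have ei : incident e (inl i) by have := set11 e; rewrite -eE inE.
exists e; move: (ei); rewrite incident_white // => /eqP we.
case be : (black_end e) => [j|v]; first by case: (@no_boundary_edge _ _ N e j i).
by apply/existsP; exists v; rewrite we eqxx -be black_endP /incident be eqxx.
Qed.

(** Counting the edges of the matching by their black ends and by their white
    ends relates the numbers of used boundary vertices of the two colors. *)
Lemma card_bd_subset P : almost_perfect P ->
  #|bd_subset P|%:Z = (net_d' N)%:Z + net_d N.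
Proof.
move=> ap.
have Eb := card_matching_by_end ap (fun e => black_endP e) (@incident_black).
have Ew := card_matching_by_end (c := false) ap (fun e => negbTE (white_endP e))
  (fun e v bv => incident_white e (negbT bv)).
rewrite net_d'E /net_d.
have -> : #|bd_subset P| =
   (#|[set i : 'I_n | (is_black (inl i : V) == true) && bd_used P i]|
   + #|[set i : 'I_n | (is_black (inl i : V) == false) && ~~ bd_used P i]|)%N.
  rewrite -(cardsID [set i : 'I_n | is_black (inl i : V)] (bd_subset P)).
  congr (_ + _)%N; apply: eq_card => i; rewrite !inE /bd_subset;
    by case: (is_black (inl i : V)); rewrite ?andbT ?andbF.
have -> : #|[set i : 'I_n | ~~ is_black (inl i : V)]| =
   (#|[set i : 'I_n | (is_black (inl i : V) == false) && bd_used P i]|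
   + #|[set i : 'I_n | (is_black (inl i : V) == false) && ~~ bd_used P i]|)%N.
  rewrite -(cardsID [set i : 'I_n | bd_used P i]).
  by congr (_ + _)%N; apply: eq_card => i; rewrite !inE eqbF_neg // andbC.
have e1 : #|[set v : ivert N | is_black (inr v : V)]| =
  #|[set v : ivert N | is_black (inr v : V) == true]|.
  by apply: eq_card => v; rewrite !inE eqb_id.
have e2 : #|[set v : ivert N | ~~ is_black (inr v : V)]| =
  #|[set v : ivert N | is_black (inr v : V) == false]|.
  by apply: eq_card => v; rewrite !inE eqbF_neg.
by rewrite e1 e2; lia.
Qed.

Definition other_end e v : V :=
  if black_end e == v then white_end e else black_end e.

Lemma other_end_incident e v : incident e (other_end e v).
Proof. by rewrite /other_end /incident; case: ifP => _; rewrite eqxx ?orbT. Qed.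

Lemma other_endK e v : incident e v -> other_end e (other_end e v) = v.
Proof.
have := ends_neq e; rewrite /other_end /incident => ne.
have [->|bv] /= := eqVneq (black_end e) v; last by move=> /eqP <-; rewrite eqxx.
by case: eqP => // E; move: ne; rewrite -E.
Qed.

Lemma other_end_neq e v : other_end e v != v.
Proof.
have := ends_neq e; rewrite /other_end => ne.
by have [<-|//] := eqVneq (black_end e) v; rewrite eq_sym.
Qed.

(** A vertex that the matching does not use is its own partner. *)
Definition partner P v : V :=
  if [pick e in P | incident e v] is Some e then other_end e v else v.

Lemma boundary_edge_unique e e' i :
  incident e (inl i) -> incident e' (inl i) -> e = e'.
Proof.
have /eqP/cards1P[e0 E] := @boundary_deg1 _ _ N i.
have in0 e1 : incident e1 (inl i) -> e1 = e0.
  by move=> ei; apply/set1P; rewrite -E inE.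
by move=> /in0 -> /in0 ->.
Qed.

Lemma matching_unique P e e' v : almost_perfect P -> e \in P -> e' \in P ->
  incident e v -> incident e' v -> e = e'.
Proof.
case: v => [i|v] /forallP ap eP e'P ev ev'; first exact: boundary_edge_unique ev ev'.
have /cards1P[e0 E] := ap v.
by transitivity e0; [|apply/esym]; apply/set1P; rewrite -E inE ?eP ?e'P.
Qed.

Lemma partner_edge P e v : almost_perfect P -> e \in P -> incident e v ->
  partner P v = other_end e v.
Proof.
move=> ap eP ev; rewrite /partner; case: pickP => [e' /andP[e'P ev']|/(_ e)].
  by rewrite (matching_unique ap eP e'P ev ev').
by rewrite eP ev.
Qed.

Lemma partner_moveP P v :
  reflect (exists2 e, e \in P & incident e v) (partner P v != v).
Proof.
rewrite /partner; case: pickP => [e /andP[eP ev]|none].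
  by rewrite other_end_neq; constructor; exists e.
by rewrite eqxx; constructor => -[e eP ev]; have := none e; rewrite eP ev.
Qed.

Lemma partnerK P : almost_perfect P -> involutive (partner P).
Proof.
move=> ap v; rewrite {2}/partner; case: pickP => [e /andP[eP ev]|none].
  by rewrite (partner_edge ap eP) ?other_end_incident ?other_endK.
by rewrite /partner; case: pickP => // e; rewrite none.
Qed.

Lemma partner_inner P (v : ivert N) : almost_perfect P -> partner P (inr v) != inr v.
Proof.
move=> /forallP/(_ v)/cards1P[e E]; apply/partner_moveP; exists e;
  by have := set11 e; rewrite -E inE => /andP[].
Qed.

Lemma partner_boundary P i : (partner P (inl i) != inl i) = bd_used P i.
Proof.
apply/partner_moveP/existsP => [[e eP ei]|[e /andP[eP ei]]]; exists e => //.
by rewrite eP.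
Qed.

Definition adj U : rel V := fun u v => [exists e in U, incident e u && incident e v].

(** In the applications U is the union of two matchings, which does not
    change when they are swapped on a component. *)
Definition component U v : {set V} := [set w | connect (adj U) v w].

Lemma adj_sym U : symmetric (adj U).
Proof. by move=> u v; apply: eq_existsb => e; rewrite [incident e u && _]andbC. Qed.

Lemma connect_adj_sym U : connect_sym (adj U).
Proof. exact/sym_connect_sym/adj_sym. Qed.

Definition closed_under U C :=
  forall e u v, e \in U -> incident e u -> incident e v -> (u \in C) = (v \in C).

Lemma component_is_closed U v : closed_under U (component U v).
Proof.
move=> e u w eU eu ew; rewrite !inE.
apply: (same_connect_r (connect_adj_sym U)); apply: connect1.
by apply/existsP; exists e; rewrite eU eu.
Qed.

Lemma component_refl U v : v \in component U v.
Proof. by rewrite inE connect0. Qed.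

Lemma component_eq U u v : v \in component U u -> component U v = component U u.
Proof.
rewrite inE => uv; apply/setP => w; rewrite !inE.
by rewrite (same_connect (connect_adj_sym U) uv).
Qed.

(** This makes [two_ends] applicable to the components of a superposition. *)
Lemma connect_adj_link P Q v : almost_perfect P -> almost_perfect Q ->
  connect (adj (P :|: Q)) v =1 connect (link (partner P) (partner Q)) v.
Proof.
move=> aP aQ w; apply/idP/idP; move: v w; apply: connect_sub => u v.
  case/existsP => e /and3P[]; rewrite inE => ePQ eu ev.
  have [->|uv] := eqVneq u v; first exact: connect0.
  have Eo : other_end e u = v.
    move: eu ev uv; rewrite /incident /other_end.
    by do 4![case: eqP => //= ?; subst] => //; rewrite ?eqxx.
  apply: connect1; rewrite /link; case/orP: ePQ => eX.
    by rewrite (partner_edge aP eX eu) Eo eqxx.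
  by rewrite (partner_edge aQ eX eu) Eo eqxx orbT.
have step (X : {set edge N}) :
    X \subset P :|: Q -> connect (adj (P :|: Q)) u (partner X u).
  move=> sX; rewrite /partner; case: pickP => [e /andP[eX eu]|_]; last exact: connect0.
  apply: connect1; apply/existsP; exists e.
  by rewrite (subsetP sX) // eu other_end_incident.
by case/orP => /eqP <-; apply: step; [exact: subsetUl|exact: subsetUr].
Qed.

Definition swap C P Q : {set edge N} :=
  [set e | if black_end e \in C then e \in Q else e \in P].

Lemma swapK C P Q : swap C (swap C P Q) (swap C Q P) = P.
Proof. by apply/setP => e; rewrite !inE; case: (black_end e \in C). Qed.

Lemma swapU C P Q : swap C P Q :|: swap C Q P = P :|: Q.
Proof. by apply/setP => e; rewrite !inE; case: (black_end e \in C); rewrite // orbC. Qed.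

Lemma swap_incident C P Q v : closed_under (P :|: Q) C ->
  [set e in swap C P Q | incident e v] =
  [set e in if v \in C then Q else P | incident e v].
Proof.
move=> clC; apply/setP => e; rewrite !inE.
case ev: (incident e v); rewrite ?andbF //= !andbT.
have [eU|] := boolP (e \in P :|: Q).
  rewrite (clC e (black_end e) v) //; first by case: ifP.
  by rewrite /incident eqxx.
by rewrite inE negb_or => /andP[/negPf eP /negPf eQ]; do 2!case: ifP; rewrite ?eP ?eQ.
Qed.

Lemma swap_perfect C P Q : closed_under (P :|: Q) C ->
  almost_perfect P -> almost_perfect Q -> almost_perfect (swap C P Q).
Proof.
move=> clC /forallP aP /forallP aQ; apply/forallP => v.
by rewrite swap_incident //; case: ifP.
Qed.

Lemma bd_usedE P i : bd_used P i = ([set e in P | incident e (inl i)] != set0).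
Proof.
apply/existsP/set0Pn => -[e]; first by exists e; rewrite inE.
by rewrite inE; exists e.
Qed.

Lemma bd_subset_swap C P Q i : closed_under (P :|: Q) C ->
  (i \in bd_subset (swap C P Q)) =
  (if inl i \in C then i \in bd_subset Q else i \in bd_subset P).
Proof. by move=> clC; rewrite !inE !bd_usedE swap_incident //; case: (_ \in C). Qed.

Lemma wt_swap C P Q : wt (swap C P Q) * wt (swap C Q P) = wt P * wt Q.
Proof.
rewrite /wt ![\prod_(_ in _) _]big_mkcond /= -!big_split /=; apply: eq_bigr => e _.
by rewrite !inE; case: (black_end e \in C); rewrite // mulrC.
Qed.

(** These are the boundary vertices used by exactly one of the two matchings:
    the ends of the paths in their superposition. *)
Definition diffs P Q : {set 'I_n} :=
  [set i | (i \in bd_subset P) (+) (i \in bd_subset Q)].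

Lemma diffsC P Q : diffs P Q = diffs Q P.
Proof. by apply/setP => i; rewrite !inE addbC. Qed.

Lemma in_diffs P Q i : i \in diffs P Q =
  ((partner P (inl i) != inl i) (+) (partner Q (inl i) != inl i)).
Proof.
rewrite !partner_boundary !inE; case: ifP => // _.
by rewrite addbN addNb negbK.
Qed.

(** A component that contains a vertex fixed by exactly one of the two
    partner maps is a path with two ends, by [two_ends]. The other end is on
    the boundary, because interior vertices are matched, and it is not fixed
    by both maps, because then it would be isolated. *)
Lemma mate_exists P Q i : almost_perfect P -> almost_perfect Q -> i \in diffs P Q ->
  exists2 j, j != i &
    [set h in diffs P Q | inl h \in component (P :|: Q) (inl i)] = [set i; j].
Proof.
wlog fixP : P Q / partner P (inl i) = inl i => [hw aP aQ iD|aP aQ].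
  have [Pi|nPi] := eqVneq (partner P (inl i)) (inl i); first exact: hw.
  have [Qi|nQi] := eqVneq (partner Q (inl i)) (inl i).
    by rewrite diffsC setUC; apply: hw; rewrite // diffsC.
  by move: iD; rewrite in_diffs nPi nQi.
rewrite in_diffs fixP eqxx /= => moveQ.
have [y yi endsE] := two_ends (partnerK aP) (partnerK aQ) fixP moveQ.
have endE v : (v \in component (P :|: Q) (inl i)) &&
    ((partner P v == v) || (partner Q v == v)) = (v == inl i) || (v == y).
  by have /setP/(_ v) := endsE; rewrite !inE connect_adj_link.
have := endE y; rewrite eqxx orbT => /andP[yC yfix].
case: y => [j|v] in yi endsE endE yC yfix *; last first.
  by move: yfix; rewrite !(negPf (partner_inner _ _)).
have iso v : partner P v = v -> partner Q v = v -> component (P :|: Q) v = [set v].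
  move=> Pv Qv; apply/setP => w; rewrite !inE connect_adj_link //.
  apply/idP/eqP => [/connectP[p + ->]|->]; last exact: connect0.
  elim: p => //= u p IHp /andP[]; rewrite {1}/link Pv Qv orbb => /eqP <-; exact: IHp.
exists j; first by [].
apply/setP => h; rewrite [LHS]in_set in_set2 in_diffs.
have := endE (inl h); rewrite !(inj_eq inl_inj) => <-.
rewrite andbC; have [hC|//] := boolP (inl h \in component (P :|: Q) (inl i)).
have [Ph|] := eqVneq (partner P (inl h)) (inl h); last first.
  by move=> _; case: (partner Q (inl h) == inl h).
have [Qh|//] := eqVneq (partner Q (inl h)) (inl h).
have := component_refl (P :|: Q) (inl i).
rewrite -(component_eq hC) iso // inE => /eqP E.
by move: moveQ; rewrite E Qh eqxx.
Qed.
End Matchings.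

(** * Components of a superposition do not cross *)

Section Embedded.
Variables (R : realType) (n : nat) (N : network R n) (emb : disk_embedding N).
Local Notation V := ('I_n + ivert N)%type.
Implicit Types (P Q U : {set edge N}) (C : {set V}) (e : edge N) (u v w : V) (i : 'I_n).

(** Edges contribute the points at interior parameters only, so that the
    points of the region split into the cases that the axioms of an embedding
    distinguish. *)
Definition region C : set (R * R) := [set p | (exists2 v, v \in C & p = vpos emb v) \/
  (exists e t, [/\ t \in `]0, 1[%R, black_end e \in C, white_end e \in C
    & p = curve emb e t])]%classic.

Lemma region_disk C : (region C `<=` @disk R)%classic.
Proof.
move=> p [[[i|v] _ ->]|[e [t [t01 _ _ ->]]]].
- by rewrite vpos_boundary /disk /= cos2Dsin2.
- exact/ltW/vpos_interior.
- by apply: curve_in_disk; apply: subset_itv_oo_cc.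
Qed.

Lemma region_disjoint C C' : [disjoint C & C'] -> forall p, region C p -> ~ region C' p.
Proof.
move=> dis p.
have inF v : v \in C -> v \in C' -> False.
  by move=> vC; rewrite (disjointFr dis vC).
case=> [[v vC ->]|[e [t [t01 bC wC ->]]]] [[v' vC']|[e' [t' [t01' bC' wC']]]].
- by move/vpos_inj => E; apply: (inF v) => //; rewrite E.
- by move/esym; apply: curve_avoids_vertices.
- exact: curve_avoids_vertices.
- apply: curve_disjoint => //; apply/eqP => E.
  by apply: (inF (black_end e)) => //; rewrite E.
Qed.

Lemma joined_edge C e : black_end e \in C -> white_end e \in C ->
  joined (region C) (vpos emb (black_end e)) (vpos emb (white_end e)).
Proof.
move=> bC wC; rewrite -curve0 -curve1; apply: joined_arc.
  exact: curve_continuous.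
move=> t; rewrite in_itv /= => /andP[]; rewrite le_eqVlt => /orP[/eqP<- _|t0].
  by left; exists (black_end e); rewrite // curve0.
rewrite le_eqVlt => /orP[/eqP->|t1].
  by left; exists (white_end e); rewrite // curve1.
by right; exists e, t; rewrite in_itv /= t0.
Qed.

Lemma joined_component U u v : v \in component U u ->
  joined (region (component U u)) (vpos emb u) (vpos emb v).
Proof.
rewrite inE => /connectP[p + ->]; have := component_refl U u.
elim: p {1 3 5 6}u => [|w p IHp] x xC /=.
  by move=> _; apply: joined_refl; left; exists x.
case/andP => /existsP[e /and3P[eU ex ew]] pw.
have wC : w \in component U u by rewrite -(component_is_closed _ eU ex ew).
apply: joined_trans (IHp w wC pw).
have inC y : incident e y -> y \in component U u.
  by move=> ey; rewrite -(component_is_closed _ eU ex ey).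
have bC : black_end e \in component U u by apply: inC; rewrite /incident eqxx.
have eC : white_end e \in component U u by apply: inC; rewrite /incident eqxx orbT.
have jbw := joined_edge bC eC.
have jx y : y \in component U u ->
    joined (region (component U u)) (vpos emb y) (vpos emb y).
  by move=> yC; apply: joined_refl; left; exists y.
case/orP: ex => /eqP ex; case/orP: ew => /eqP ew; rewrite -?ex -?ew in xC wC *;
  by [exact: jx|exact: jbw|exact: joined_sym].
Qed.

(** If the two components were disjoint, the part of the disk covered by each
    of them would contain a curve joining two boundary points, and the two
    pairs of boundary points would be interlaced, contrary to [curves_cross]. *)
Lemma components_noncrossing U (i0 i1 i2 i3 : 'I_n) :
  (i0 < i1)%N -> (i1 < i2)%N -> (i2 < i3)%N ->
  inl i2 \in component U (inl i0) -> inl i3 \in component U (inl i1) ->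
  inl i1 \in component U (inl i0).
Proof.
move=> i01 i12 i23 C02 C13; apply: contraT => nC.
have dis : [disjoint component U (inl i0) & component U (inl i1)].
  apply/pred0P => v /=; apply/negP => /andP[v0 v1].
  by rewrite -(component_eq v0) (component_eq v1) component_refl in nC.
have [f [fc f0 f1 fS]] := joined_component C02.
have [g [gc g0 g1 gS]] := joined_component C13.
have [] := @curves_cross R (bangle emb i0) (bangle emb i1) (bangle emb i2)
  (bangle emb i3) f g.
- by have /andP[] := bangle_clockwise emb i01.
- by have /andP[] := bangle_clockwise emb i12.
- by have /andP[] := bangle_clockwise emb i23.
- have i03 : (i0 < i3)%N by lia.
  by have /andP[] := bangle_clockwise emb i03; lra.
- by [].
- by [].
- by move=> s; apply: region_disk (fS s).
- by move=> s; apply: region_disk (gS s).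
- by rewrite f0 // vpos_boundary.
- by rewrite f1 // vpos_boundary.
- by rewrite g0 // vpos_boundary.
- by rewrite g1 // vpos_boundary.
move=> s [t E]; exfalso; apply: (region_disjoint dis (fS s)); rewrite E; exact: gS.
Qed.

(** The other end of the path that ends at i. It depends only on the set D of
    ends and on the union U of the matchings, both of which are unchanged by
    a swap. *)
Definition mate (D : {set 'I_n}) U i : 'I_n :=
  odflt i [pick j | [&& j != i, j \in D & inl j \in component U (inl i)]].

Section Mates.
Variables (P Q : {set edge N}).
Hypotheses (aP : almost_perfect P) (aQ : almost_perfect Q).
Let D := diffs P Q.
Let U := P :|: Q.
Local Notation mate := (mate D U).

Lemma mate_set i : i \in D ->
  [set h in D | inl h \in component U (inl i)] = [set i; mate i].
Proof.
move=> iD; have [j ji E] := mate_exists aP aQ iD; rewrite E /mate.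
have inE' h : (h \in D) && (inl h \in component U (inl i)) = (h == i) || (h == j).
  by rewrite -[RHS]in_set2 -E inE.
case: pickP => [j' /=|/(_ j)]; last by rewrite inE' ji eqxx orbT.
by rewrite inE' => /andP[/negPf->] /eqP ->.
Qed.

Lemma mate_neq i : i \in D -> mate i != i.
Proof.
move=> iD; have [j ji E] := mate_exists aP aQ iD.
have : j \in [set i; mate i] by rewrite -mate_set // E in_set2 eqxx orbT.
by rewrite !inE (negPf ji) /= => /eqP <-.
Qed.

Lemma mate_in i : i \in D -> mate i \in D.
Proof.
move=> iD; have : mate i \in [set i; mate i] by rewrite in_set2 eqxx orbT.
by rewrite -mate_set // inE => /andP[].
Qed.

Lemma mate_component i : i \in D -> inl (mate i) \in component U (inl i).
Proof.
move=> iD; have : mate i \in [set i; mate i] by rewrite in_set2 eqxx orbT.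
by rewrite -mate_set // inE => /andP[].
Qed.

Lemma mate_only i h : i \in D -> h \in D -> inl h \in component U (inl i) ->
  h = i \/ h = mate i.
Proof.
move=> iD hD hC; have : h \in [set i; mate i] by rewrite -mate_set // inE hD.
by rewrite !inE => /orP[] /eqP; [left|right].
Qed.

Lemma mateK i : i \in D -> mate (mate i) = i.
Proof.
move=> iD; have mD := mate_in iD.
have := mate_component mD; rewrite (component_eq (mate_component iD)).
move=> /(mate_only iD (mate_in mD)) [//|E].
by have := mate_neq mD; rewrite E eqxx.
Qed.

(** Otherwise the path from h to its mate would have ends interlaced with
    those of the path from i to its mate. *)
Lemma mate_between i h : i \in D -> h \in D ->
  (i < h < mate i)%N -> (i < mate h < mate i)%N.
Proof.
move=> iD hD /andP[ih hm]; rewrite !ltnNge -negb_or; apply/negP.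
have hC : inl h \notin component U (inl i).
  apply/negP => /(mate_only iD hD)[E|E].
    by rewrite E ltnn in ih.
  by rewrite E ltnn in hm.
have iC : inl i \notin component U (inl h).
  apply: contra hC => /component_eq ->; exact: component_refl.
have mhi : mate h != i.
  by apply: contraNneq iC => <-; exact: mate_component.
have mhm : mate h != mate i.
  apply: contraNneq hC => E; rewrite -(component_eq (mate_component iD)) -E.
  rewrite (component_eq (mate_component hD)); exact: component_refl.
case/orP => le.
  have lt : (mate h < i)%N by rewrite ltn_neqAle le andbT.
  have := @components_noncrossing U _ _ _ _ lt ih hm.
  rewrite (component_eq (mate_component hD)).
  by rewrite component_refl mate_component // (negPf iC) => /(_ isT isT).
have lt : (mate i < mate h)%N by rewrite ltn_neqAle le andbT eq_sym.
have := @components_noncrossing U _ _ _ _ ih hm lt.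
by rewrite !mate_component // (negPf hC) => /(_ isT isT).
Qed.

End Mates.
End Embedded.

(** * The Plucker relations for boundary measurements *)

Section Parity.
Variable n : nat.
Implicit Types (S A B : {set 'I_n}) (x y z : 'I_n).

(** The elements that move up are in bijection with those that move down. *)
Lemma even_card_involution S (f : 'I_n -> 'I_n) :
  {in S, forall z, f z \in S} -> {in S, forall z, f (f z) = z} ->
  {in S, forall z, f z != z} -> ~~ odd #|S|.
Proof.
move=> fS fK fne; pose L := [set z in S | (z < f z)%N].
have E : S :\: L = f @: L.
  apply/setP => z; apply/idP/imsetP => [|[w]].
    rewrite !inE => /andP[nl zS]; exists (f z); last by rewrite fK.
    rewrite inE fS // fK //= ltn_neqAle (fne z) //=.
    by move: nl; rewrite zS /= -leqNgt.
  rewrite !inE => /andP[wS lt] ->.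
  by rewrite fS // fK //= -leqNgt ltnW.
rewrite -(cardsID L S) E card_in_imset; last first.
  move=> z w; rewrite !inE => /andP[zS _] /andP[wS _] /(congr1 f).
  by rewrite !fK.
rewrite (_ : S :&: L = L) ?addnn ?odd_double //.
by apply/setIidPr/subsetP => z; rewrite inE => /andP[].
Qed.

Lemma odd_card S : odd #|S| = \big[addb/false]_z (z \in S).
Proof.
rewrite -sum1_card (big_morph odd oddD (erefl _)) [LHS]big_mkcond /=.
by apply: eq_bigr => z _; case: (z \in S).
Qed.

(** Over the three cardinalities together, every element other than x is
    counted an even number of times, and x once. *)
Lemma odd_below_between A B x y : x \notin A -> x \in B -> (x < y)%N ->
  odd (below A y + below B y) = odd (below A x + below B x)
    (+) ~~ odd #|[set z | (z \in A) (+) (z \in B) & (x < z < y)%N]|.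
Proof.
move=> xA xB xy; set M := [set z | _ & _].
have E : odd (below A y + below B y) (+) odd (below A x + below B x) (+) odd #|M|.
  rewrite !oddD /below !odd_card -!big_split /=.
  rewrite (eq_bigr (fun z => z \in [set x])); first by rewrite -odd_card cards1.
  move=> z _; rewrite !inE; case: (ltngtP z x) => [zx|xz|/val_inj ->].
  - rewrite (ltn_trans zx xy) !andbT andbF addbF addbb.
    by rewrite -val_eqE /= ltn_eqF.
  - rewrite !andbF !addbF -val_eqE /= gtn_eqF //=.
    by case: (z < y)%N; rewrite ?andbT ?andbF ?addbb.
  - by rewrite (negPf xA) xB xy eqxx.
by move: E; do 3!case: (odd _).
Qed.
End Parity.

Section PluckerMatchings.
Variables (R : realType) (n : nat) (N : network R n) (emb : disk_embedding N).
Implicit Types (P Q : {set edge N}) (A B : {set 'I_n}).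

(** The two matchings are swapped along the path that starts at x, and x is
    replaced by the other end of that path. *)
Definition exchange (t : 'I_n * ({set edge N} * {set edge N})) :=
  let: (x, (P, Q)) := t in
  let U := P :|: Q in
  let C := component U (inl x) in
  (mate (diffs P Q) U x, (swap C P Q, swap C Q P)).

(** The configurations counted by the Plucker relation for A and B: the index
    x of a term and a pair of matchings that contributes to it. *)
Definition exchange_config A B (t : 'I_n * ({set edge N} * {set edge N})) : bool :=
  [&& t.1 \in B :\: A, almost_perfect t.2.1 && (bd_subset t.2.1 == t.1 |: A)
    & almost_perfect t.2.2 && (bd_subset t.2.2 == B :\ t.1)].

Lemma diffs_exchange A B x P Q : exchange_config A B (x, (P, Q)) ->
  diffs P Q = [set z | (z \in A) (+) (z \in B)].
Proof.
rewrite /exchange_config /= => /and3P[xBA /andP[_ /eqP bP] /andP[_ /eqP bQ]].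
apply/setP => z; rewrite [LHS]in_set bP bQ !inE.
have [->|//] := eqVneq z x.
by move: xBA; rewrite inE => /andP[/negPf -> ->].
Qed.

(** The elements of the symmetric difference of A and B between x and its
    mate are paired off by [mate_between], so their number is even. *)
Lemma odd_below_mate A B x P Q : exchange_config A B (x, (P, Q)) ->
  let y := mate (diffs P Q) (P :|: Q) x in y \in B :\: A ->
  odd (below A y + below B y) = ~~ odd (below A x + below B x).
Proof.
move=> cfg y; have Dset := diffs_exchange cfg.
move: (cfg); rewrite /exchange_config /= => /and3P[xBA /andP[aP _] /andP[aQ _]].
rewrite [y \in _]inE => /andP[yA yB].
move: xBA; rewrite inE => /andP[xA xB].
have xD : x \in diffs P Q by rewrite Dset inE (negPf xA) xB.
have yD : y \in diffs P Q by exact: mate_in.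
have yx : y != x by exact: mate_neq.
have even i : i \in diffs P Q ->
    ~~ odd #|[set z | (z \in A) (+) (z \in B)
      & (i < z < mate (diffs P Q) (P :|: Q) i)%N]|.
  move=> iD; apply: (even_card_involution (f := mate (diffs P Q) (P :|: Q))) => z;
    rewrite inE => /andP[zAB zb];
    have zD : z \in diffs P Q by rewrite Dset inE.
  - rewrite inE (mate_between emb aP aQ iD zD zb) andbT.
    by have := mate_in aP aQ zD; rewrite {2}Dset inE.
  - exact: mateK.
  - exact: mate_neq.
have [xy|yx'|/val_inj E] := ltngtP x y; last by rewrite E eqxx in yx.
  by rewrite (odd_below_between xA xB xy) even // addbT.
rewrite (odd_below_between yA yB yx').
have -> : x = mate (diffs P Q) (P :|: Q) y by rewrite /y mateK.
by rewrite even // addbT negbK.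
Qed.

(** Only x and its mate y change sides in the swap. If y were in the boundary
    subset of P, the swap would remove x and y from it, which is impossible
    because all boundary subsets have k elements. Hence y is in the boundary
    subset of Q only, that is, in B but not in A. *)
Lemma exchange_config_stable k A B x P Q : k%:Z = (net_d' N)%:Z + net_d N ->
  #|A|.+1 = k -> exchange_config A B (x, (P, Q)) ->
  exchange_config A B (exchange (x, (P, Q))).
Proof.
move=> kE Ak cfg; have Dset := diffs_exchange cfg; rewrite /exchange.
set C := component _ _; set y := mate _ _ _.
move: (cfg); rewrite /exchange_config /=.
case/and3P => xBA /andP[aP /eqP bP] /andP[aQ /eqP bQ].
move: xBA; rewrite inE => /andP[xA xB].
have xD : x \in diffs P Q by rewrite Dset inE (negPf xA) xB.
have yD : y \in diffs P Q by exact: mate_in.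
have yx : y != x by exact: mate_neq.
have clC : closed_under (P :|: Q) C by exact: component_is_closed.
have clC' : closed_under (Q :|: P) C by rewrite setUC.
have xC : inl x \in C by exact: component_refl.
have yC : inl y \in C by exact: mate_component.
have aP' := swap_perfect clC aP aQ; have aQ' := swap_perfect clC' aQ aP.
have outside z : z != x -> z != y -> inl z \in C ->
    (z \in bd_subset P) = (z \in bd_subset Q).
  move=> zx zy zC; apply/eqP; rewrite -[_ == _]negbK -negb_add negbK.
  have : z \notin diffs P Q.
    by apply/negP => /(mate_only aP aQ xD) /(_ zC)[] /eqP; apply/negP.
  by rewrite inE.
have xP : x \in bd_subset P by rewrite bP setU11.
have xQ : x \notin bd_subset Q by rewrite bQ !inE eqxx.
have yP : y \notin bd_subset P.
  apply/negP => yP.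
  have : (#|bd_subset (swap C P Q)| < #|bd_subset P|)%N.
    apply: proper_card; apply/properP; split; last first.
      by exists x; rewrite // bd_subset_swap // xC.
    apply/subsetP => z; rewrite bd_subset_swap //; case: ifP => // zC zQ.
    have [->//|zy] := eqVneq z y.
    by rewrite outside //; apply: contraNneq xQ => <-.
  suff -> : #|bd_subset (swap C P Q)| = #|bd_subset P| by rewrite ltnn.
  by apply/eqP; rewrite -eqz_nat !card_bd_subset.
have yQ : y \in bd_subset Q by move: yD; rewrite inE (negPf yP).
rewrite aP' aQ' !inE /=.
move: yP yQ; rewrite bP bQ !inE negb_or yx /= => yA yB; rewrite yA yB /=.
apply/andP; split; apply/eqP/setP => z; rewrite bd_subset_swap //.
  have [->|zy] := eqVneq z y; first by rewrite yC bQ !inE eqxx yx yB.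
  have [->|zx] := eqVneq z x.
    by rewrite xC (negPf xQ) !inE (negPf xA) orbF eq_sym (negPf yx).
  case: ifP => zC; rewrite -?outside // bP !inE (negPf zx) (negPf zy) //.
have [->|zy] := eqVneq z y; first by rewrite yC bP !inE eqxx (negPf yx) (negPf yA).
have [->|zx] := eqVneq z x.
  by rewrite xC xP !inE xB eq_sym yx.
by case: ifP => zC; rewrite ?outside // bQ !inE zx zy.
Qed.

Lemma exchangeK A B t : exchange_config A B t -> exchange (exchange t) = t.
Proof.
case: t => x [P Q] cfg; rewrite /exchange swapU.
set C := component _ (inl x); set y := mate _ _ x.
move: (cfg); rewrite /exchange_config /=.
case/and3P => xBA /andP[aP _] /andP[aQ _].
have xD : x \in diffs P Q.
  by rewrite (diffs_exchange cfg) inE; move: xBA; rewrite inE => /andP[/negPf-> ->].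
have yC : inl y \in C by exact: mate_component.
rewrite (component_eq yC) -/C !swapK.
have clC : closed_under (P :|: Q) C by exact: component_is_closed.
have clC' : closed_under (Q :|: P) C by rewrite setUC.
have -> : diffs (swap C P Q) (swap C Q P) = diffs P Q.
  apply/setP => z; rewrite /diffs [LHS]in_set [RHS]in_set.
  by rewrite !bd_subset_swap //; case: ifP => // _; rewrite addbC.
by rewrite mateK.
Qed.

(** The exchange is an involution on configurations that preserves the
    product of the weights and reverses the sign of the term. *)
Theorem plucker_boundary_measurement k : k%:Z = (net_d' N)%:Z + net_d N ->
  plucker_relations k (boundary_measurement N).
Proof.
move=> kE A B Ak _.
pose F (t : 'I_n * ({set edge N} * {set edge N})) :=
  (-1) ^+ (below A t.1 + below B t.1) * (wt t.2.1 * wt t.2.2) : R.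
transitivity (\sum_(t | exchange_config A B t) F t).
  rewrite (eq_bigr (fun x => \sum_(PQ : {set edge N} * {set edge N} |
      (almost_perfect PQ.1 && (bd_subset PQ.1 == x |: A)) &&
      (almost_perfect PQ.2 && (bd_subset PQ.2 == B :\ x))) F (x, PQ))).
    by rewrite pair_big_dep /=; apply: eq_big => -[x [P Q]].
  move=> x _; rewrite /boundary_measurement big_distrlr /= pair_big /=.
  by rewrite big_distrr.
have neg t : exchange_config A B t -> F (exchange t) = - F t.
  case: t => x [P Q] cfg; have cfg' := exchange_config_stable kE Ak cfg.
  rewrite /F /= wt_swap -signr_odd odd_below_mate //.
    by rewrite signrN mulNr signr_odd.
  by move: cfg'; rewrite /exchange_config /= => /andP[].
have conf t : exchange_config A B t -> exchange_config A B (exchange t).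
  by case: t => x [P Q] cfg; exact: (exchange_config_stable kE Ak cfg).
have : \sum_(t | exchange_config A B t) F t = - \sum_(t | exchange_config A B t) F t.
  rewrite {1}(reindex_onto exchange exchange) /=; last by move=> t; exact: exchangeK.
  have E t : exchange_config A B (exchange t) && (exchange (exchange t) == t) =
      exchange_config A B t.
    apply/andP/idP => [[ct /eqP <-]|ct]; first exact: conf.
    by rewrite (exchangeK ct) conf.
  by rewrite (eq_bigl _ _ E) -sumrN; apply: eq_bigr => t; exact: neg.
by lra.
Qed.
End PluckerMatchings.

Local Open Scope complex_scope.

Theorem theorem4p1 (R : realType) (n : nat) (N : network R n)
    (emb : disk_embedding N)
    (weight_ge0 : forall e : edge N, 0 <= weight e)
    (matching_exists :
       exists Pi : {set edge N}, almost_perfect Pi /\ wt Pi != 0) :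
  exists k : nat, k%:Z = (net_d' N)%:Z + net_d N /\
    exists X : Gr R[i] k n,
      plucker_coordinates X
        (fun I : ksubset k n => (boundary_measurement N (val I))%:C).
Proof.
have [Pi [aPi wPi]] := matching_exists.
exists #|bd_subset Pi|; rewrite card_bd_subset //; split=> //.
have kE := card_bd_subset aPi.
pose I0 : ksubset #|bd_subset Pi| n := exist _ (bd_subset Pi) (eqxx _).
apply: (plucker_point (p := fun I => (boundary_measurement N I)%:C) (I0 := I0)).
  move=> A B Ak Bk; have := plucker_boundary_measurement emb kE Ak Bk.
  move=> /(congr1 (real_complex R)) /=; rewrite rmorph0 rmorph_sum /= => E.
  rewrite -[RHS]E.
  by apply: eq_bigr => x _; rewrite !rmorphM rmorphXn rmorphN1.
have w0 (P : {set edge N}) : 0 <= wt P by apply: prodr_ge0 => e _; exact: weight_ge0.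
rewrite fmorph_eq0 gt_eqF // /boundary_measurement (bigD1 Pi) /= ?aPi ?eqxx //.
by rewrite ltr_pwDl ?sumr_ge0 // lt0r wPi w0.
Qed.
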